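(* Let $\mathcal{F}\subseteq(\omega)^\omega$ be a game-family and let $\Phi$ be a sentence of the forcing language of $\mathbb{P}_{\mathcal{F}}$. For every $\mathbb{P}_{\mathcal{F}}$-condition $\langle s,X\rangle$ there is a $\mathbb{P}_{\mathcal{F}}$-condition $\langle s,Y\rangle\le\langle s,X\rangle$ (with the same first coordinate $s$) such that $\langle s,Y\rangle\Vdash_{\mathbb{P}_{\mathcal{F}}}\Phi$ or $\langle s,Y\rangle\Vdash_{\mathbb{P}_{\mathcal{F}}}\neg\Phi$.
   Context: A partition of $\omega$ is a set of nonempty pairwise disjoint subsets (blocks) of $\omega$ whose union is $\omega$; $(\omega)^\omega$ is the set of partitions with infinitely many blocks. A partial partition is a set of nonempty pairwise disjoint subsets of $\omega$, with domain the union of its blocks; $(\mathbb{N})$ denotes the set of partial partitions whose domain is a natural number $n=\{0,\dots,n-1\}$; for $s\in(\mathbb{N})$, $|s|$ is its number of blocks and $s^*=s\cup\{\{\mathrm{dom}(s)\}\}$. For partial partitions $X_1,X_2$, $X_1\sqsubseteq X_2$ means: for every block $b$ of $X_1$, $b\cap\mathrm{dom}(X_2)$ is a union of sets $b'\cap\mathrm{dom}(X_1)$ with $b'$ a block of $X_2$. $X_1\sqcap X_2$ is the finest partial partition coarser than both with domain $\mathrm{dom}(X_1)\cup\mathrm{dom}(X_2)$; for finite $f$, $\{f\}$ is the partial partition with the single block $f$; $X_1\sqsubseteq^*X_2$ means $X_1\sqcap\{f\}\sqsubseteq X_2$ for some finite $f\subseteq\mathrm{dom}(X_1)$; $X_1\overset{*}{=}X_2$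 means $X_1\sqsubseteq^*X_2$, $X_2\sqsubseteq^*X_1$ and equal domains. $p\trianglelefteq q$ means every block of $p$ is $b\cap\mathrm{dom}(p)$ for some block $b$ of $q$. For $s\in(\mathbb{N})$, $X\in(\omega)^\omega$ with $s\sqsubseteq X$, $(s,X)^\omega=\{Y\in(\omega)^\omega: s\trianglelefteq Y\wedge Y\sqsubseteq X\}$. Let $\mathcal{F}\subseteq(\omega)^\omega$. $\mathcal{F}$ is non-principal if for every $X\in\mathcal{F}$ there is $Y\in\mathcal{F}$ with $Y\sqsubseteq X$ and not $Y\overset{*}{=}X$; closed under refinement if $X\sqsubseteq Y$ and $X\in\mathcal{F}$ imply $Y\in\mathcal{F}$; closed under finite changes if $X\sqcap s\in\mathcal{F}$ for all $s\in(\mathbb{N})$, $X\in\mathcal{F}$. For $X\in\mathcal{F}$, $s\sqsubseteq X$, the game $\mathcal{G}(\mathcal{F})$ starting with $\langle s,X\rangle$: all partitions $X_i,Y_i$ played must lie in $\mathcal{F}$. Player I plays $X_0\in(s,X)^\omega$; II plays $\langle t_0,Y_0\rangle$ with $Y_0\in(s,X_0)^\omega$, $s\trianglelefteq t_0^*\trianglelefteq Y_0$, $|t_0|=|s|$. For $n\ge1$, I plays $X_n\in(t_{n-1}^*,Y_{n-1})^\omega$ and II plays $\langle t_n,Y_n\rangle$ with $Y_n\in(t_{n-1}^*,X_n)^\omega$, $t_{n-1}^*\trianglelefteq t_n^*\trianglelefteq Y_n$, $|t_n|=|t_{n-1}|+1$. Player I wins iff the unique partition $Y$ with $t_n\trianglelefteq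 Y$ for all $n$ belongs to $\mathcal{F}$. $\mathcal{F}$ is a game-family if it is non-principal, closed under refinement and under finite changes, and player II has no winning strategy in $\mathcal{G}(\mathcal{F})$. The forcing $\mathbb{P}_{\mathcal{F}}$ has conditions $\langle s,X\rangle$ with $s\in(\mathbb{N})$, $X\in\mathcal{F}$, $s\sqsubseteq X$, ordered by $\langle s,X\rangle\le\langle t,Y\rangle$ iff $(s,X)^\omega\subseteq(t,Y)^\omega$. *)

(* Defs.v *)
From mathcomp Require Import all_boot finmap.
From mathcomp Require Import boolp classical_sets functions cardinality.

Set Implicit Arguments.
Unset Strict Implicit.
Unset Printing Implicit Defensive.

Local Open Scope classical_set_scope.

(* A set of blocks; whether the blocks are nonempty and pairwise disjoint is
   expressed by [classical_sets.partition] where it is required. *)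
Definition blocks := set (set nat).

Definition dom (X : blocks) : set nat := cover X id.

Definition partial_partition (X : blocks) : Prop :=
  classical_sets.partition X id (dom X).

Definition omega_partitions : set blocks :=
  [set X | classical_sets.partition X id setT /\ infinite_set X].

Definition segments : set blocks :=
  [set s | exists n, classical_sets.partition s id `I_n].

Definition nblocks (s : blocks) : nat := #|` fset_set s|.

(* If s is a segment then dom s = `I_n for exactly one n, so the block added
   here is the singleton [set n]. *)
Definition star (s : blocks) : blocks :=
  s `|` [set [set n | dom s = `I_n]].

Definition coarser (X1 X2 : blocks) : Prop :=
  forall b, X1 b -> exists2 S : blocks, S `<=` X2 &
    b `&` dom X2 = \bigcup_(b' in S) (b' `&` dom X1).

(* [coarser W Z] says that W is coarser than Z, so the finest candidate is the
   one that all candidates are coarser than. *)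
Definition is_meet (X1 X2 Z : blocks) : Prop :=
  let cand W := [/\ partial_partition W, dom W = dom X1 `|` dom X2,
                    coarser W X1 & coarser W X2] in
  cand Z /\ forall W, cand W -> coarser W Z.

Definition meet (X1 X2 : blocks) : blocks := get (is_meet X1 X2).

Lemma meetP X1 X2 : trivIset X1 id -> trivIset X2 id ->
  is_meet X1 X2 (meet X1 X2).
Proof.
move=> tX1 tX2; apply: getPex.
pose D := dom X1 `|` dom X2.
pose cand W := [/\ partial_partition W, dom W = D,
                    coarser W X1 & coarser W X2].
pose R x y := forall W b, cand W -> W b -> b x -> b y.
have Rxx x : R x x by [].
have Rsym x y : D x -> R x y -> R y x.
  move=> Dx Rxy W b cW Wb By.
  have [[_ tW _] dW _ _] := cW.
  have : dom W x by rewrite dW.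
  move=> -[c Wc cx].
  have cy : c y by exact: (Rxy W c).
  suff -> : b = c by [].
  by apply: tW => //; exists y.
pose Z : blocks := [set b | exists2 x, D x & b = [set y | D y /\ R x y]].
have dZ : dom Z = D.
  apply/seteqP; split=> [y [b [x Dx ->]] []//|x Dx].
  by exists [set y | D y /\ R x y] => //; exists x.
have one X : trivIset X id -> dom X `<=` D ->
    (forall W, cand W -> coarser W X) ->
    forall c x y, X c -> c x -> c y -> R x y.
  move=> tX XD cX c x y Xc cx cy W b cW Wb bx.
  have [S SX bE] := cX W cW b Wb.
  have : (b `&` dom X) x by split=> //; exists c.
  rewrite bE => -[d Sd [dx _]].
  have dc : d = c by apply: tX => //; [exact: SX|exists x].
  have : (\bigcup_(b' in S) (b' `&` dom W)) y.
    exists d => //; split; first by rewrite dc.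
    by have [_ -> _ _] := cW; apply: XD; exists c.
  by rewrite -bE => -[].
have coarserZ X : trivIset X id -> dom X `<=` D ->
    (forall W, cand W -> coarser W X) -> coarser Z X.
  move=> tX XD cX _ [x Dx ->].
  exists [set c | X c /\ exists2 y, c y & R x y] => [c []//|].
  apply/seteqP; split=> y.
    move=> [[Dy Rxy] [c Xc cy]]; exists c; first by split=> //; exists y.
    by split=> //; rewrite dZ.
  move=> [c [Xc [z cz Rxz]] [cy _]]; have Xy : dom X y by exists c.
  split=> //; split; first exact: XD.
  move=> W b cW Wb bx; apply: (one X tX XD cX c z y Xc cz cy W b cW Wb).
  exact: (Rxz W).
exists Z; split; last first.
  move=> W cW b Wb; have [[_ tW _] dW _ _] := cW.
  exists [set z | Z z /\ exists2 y, z y & b y] => [z []//|].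
  apply/seteqP; split=> y.
    move=> [By Zy]; have Dy : D y by rewrite -dZ.
    exists [set v | D v /\ R y v]; last by rewrite dW.
    by split; [exists y|exists y].
  move=> [z [[x Dx ->] [v /= [Dv Rxv] bv]] [[Dy Rxy] _]].
  split; last by rewrite dZ.
  by apply: (Rxy W b cW Wb); apply: (Rsym x v Dx Rxv W b cW Wb).
split=> //.
- split=> //.
    move=> _ _ [x Dx ->] [y Dy ->] /= [z [[Dz Rxz] [_ Ryz]]].
    by apply/seteqP; split=> v [Dv Rv]; split=> // W b cW Wb bb; apply: (Rv W b cW Wb);
      [apply: (Rsym x z Dx Rxz W b cW Wb); apply: (Ryz W b cW Wb)
      |apply: (Rsym y z Dy Ryz W b cW Wb); apply: (Rxz W b cW Wb)].
  by move=> _ [x Dx ->]; exists x.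
- by apply: coarserZ => //; [move=> x; left|move=> W []].
- by apply: coarserZ => //; [move=> x; right|move=> W []].
Qed.

Definition almost_coarser (X1 X2 : blocks) : Prop :=
  exists f : set nat, [/\ finite_set f, f `<=` dom X1 &
    coarser (meet X1 [set f]) X2].

Definition almost_eq (X1 X2 : blocks) : Prop :=
  [/\ almost_coarser X1 X2, almost_coarser X2 X1 & dom X1 = dom X2].

Definition initial (p q : blocks) : Prop :=
  forall c, p c -> exists2 b, q b & c = b `&` dom p.

(* The basic set (s, X)^omega. *)
Definition basic (s X : blocks) : set blocks :=
  [set Y | [/\ omega_partitions Y, initial s Y & coarser Y X]].

Definition non_principal (F : set blocks) : Prop :=
  forall X, F X -> exists Y, [/\ F Y, coarser Y X & ~ almost_eq Y X].

Definition closed_under_refinement (F : set blocks) : Prop :=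
  forall X Y, omega_partitions Y -> coarser X Y -> F X -> F Y.

Definition closed_under_finite_changes (F : set blocks) : Prop :=
  forall s X, segments s -> F X -> F (meet X s).

(* A strategy for II maps the list X_0, ..., X_n of the moves of I so far to
   the answer (t_n, Y_n) of II. *)
Definition strategy := seq blocks -> blocks * blocks.

Section Game.

Context (F : set blocks) (s X : blocks) (sigma : strategy).
Context (x : nat -> blocks).

Definition answer (n : nat) : blocks * blocks := sigma (mkseq x n.+1).

(* The pair whose basic set I has to play in at stage n: (s, X) at the start,
   and (t_{n-1}^*, Y_{n-1}) afterwards. *)
Definition position (n : nat) : blocks * blocks :=
  if n is m.+1 then (star (answer m).1, (answer m).2) else (s, X).

Definition required_nblocks (n : nat) : nat :=
  if n is m.+1 then (nblocks (answer m).1).+1 else nblocks s.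

Definition legalI (n : nat) : Prop :=
  F (x n) /\ basic (position n).1 (position n).2 (x n).

Definition legalII (n : nat) : Prop :=
  let: (t, Y) := answer n in let u := (position n).1 in
  [/\ segments t /\ F Y,
      basic u (x n) Y,
      initial u (star t), initial (star t) Y &
      nblocks t = required_nblocks n].

(* In a legal play the segments t_n have unbounded domains, so that there is
   exactly one such partition Y. *)
Definition winsI : Prop :=
  exists Y, [/\ classical_sets.partition Y id setT,
    forall n, initial (answer n).1 Y & F Y].

End Game.

(* The player who first makes an illegal move loses. *)
Definition winning_strategyII (F : set blocks) (s X : blocks)
    (sigma : strategy) : Prop :=
  forall x : nat -> blocks,
    (forall n, (forall m, m <= n -> legalI F s X sigma x m) ->
               legalII F s X sigma x n) /\
    ((forall n, legalI F s X sigma x n) -> ~ winsI F sigma x).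

Definition game_family (F : set blocks) : Prop :=
  [/\ non_principal F, closed_under_refinement F,
      closed_under_finite_changes F &
      forall s X, segments s -> F X -> coarser s X ->
        ~ exists sigma, winning_strategyII F s X sigma].

Record condition (F : set blocks) : Type := Condition {
  stem : blocks;
  side : blocks;
  stem_segment : segments stem;
  side_in : F side;
  stem_coarser : coarser stem side }.

Definition condition_le (F : set blocks) (p q : condition F) : Prop :=
  basic (stem p) (side p) `<=` basic (stem q) (side q).

(* A P-name is a set of pairs (name, condition), presented as a family. *)
Inductive name (P : Type) : Type :=
  Name (I : Type) of (I -> name P) & (I -> P).

Definition empty_name (P : Type) : name P :=
  @Name P void (of_void _) (of_void _).

(* First-order formulas in the language of set theory with the P-names as
   constants; [Var] is a de Bruijn index among the n free variables. *)
Inductive term (P : Type) (n : nat) : Type :=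
  | Var of 'I_n
  | Cst of name P.

Inductive formula (P : Type) : nat -> Type :=
  | FEq n of term P n & term P n : formula P n
  | FMem n of term P n & term P n : formula P n
  | FNeg n of formula P n : formula P n
  | FAnd n of formula P n & formula P n : formula P n
  | FEx n of formula P n.+1 : formula P n.

Definition sentence (P : Type) := formula P 0.

Section Forcing.

Context (P : Type) (le : P -> P -> Prop).

Definition dense_below (p : P) (D : set P) : Prop :=
  forall q, le q p -> exists2 r, le r q & D r.

(* p forces x = y iff, for each pair (z, c) in x and each q below p and c,
   q forces z \in y, and symmetrically. The clause of [forces_mem] is inlined,
   and in the second half the equation is turned around, since the recursion
   is structural in x. *)
Fixpoint forces_eq (x y : name P) (p : P) {struct x} : Prop :=
  let: Name A f a := x in
  let: Name B g b := y in
  (forall i q, le q p -> le q (a i) -> dense_below q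
     [set r | exists2 j, le r (b j) & forces_eq (f i) (g j) r]) /\
  (forall j q, le q p -> le q (b j) -> dense_below q
     [set r | exists2 i, le r (a i) & forces_eq (f i) (g j) r]).

Definition forces_mem (x y : name P) (p : P) : Prop :=
  let: Name B g b := y in
  dense_below p [set r | exists2 j, le r (b j) & forces_eq x (g j) r].

Definition eval n (e : 'I_n -> name P) (t : term P n) : name P :=
  match t with Var i => e i | Cst x => x end.

Definition extend n (x : name P) (e : 'I_n -> name P) (i : 'I_n.+1) : name P :=
  if unlift ord0 i is Some j then e j else x.

Fixpoint forces_formula n (phi : formula P n) :
    ('I_n -> name P) -> P -> Prop :=
  match phi with
  | FEq _ t u => fun e p => forces_eq (eval e t) (eval e u) p
  | FMem _ t u => fun e p => forces_mem (eval e t) (eval e u) p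
  | FNeg _ phi => fun e p => forall q, le q p -> ~ forces_formula phi e q
  | FAnd _ phi psi => fun e p => forces_formula phi e p /\ forces_formula psi e p
  | FEx _ phi => fun e p => dense_below p
      [set r | exists x, forces_formula phi (extend x e) r]
  end.

(* A sentence has no free variables: the environment is irrelevant. *)
Definition forces (p : P) (Phi : sentence P) : Prop :=
  forces_formula Phi (fun=> empty_name P) p.

End Forcing.

(* Main.v *)
Require Import Defs.
From mathcomp Require Import all_boot.
From mathcomp Require Import zify.

Set Implicit Arguments.
Unset Strict Implicit.
Unset Printing Implicit Defensive.

(** Numbering the blocks of a partition X by their minima turns X into a
surjection f : nat -> nat in which new values appear in increasing order; the
partitions coarser than X become the maps h \o f, and those in (s, X)^omega,
for an initial segment s of X with k blocks, the maps h \o f where h fixes the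
numbers below k.

A sentence splits the pairs (k, f) into those that force it, those below which
nothing forces it, and the undecided ones. Since player II has no winning
strategy, fusion is available inside the family: below any f there is a g in
the family all of whose coarsenings in the family are decided. The
one-block-longer extensions of (k, g) then have one of two colours, and a
homogeneous coarsening in the family is provided by a version of the
Carlson-Simpson theorem. Its proof combines fusion with the Hales-Jewett
theorem: if a colour cannot be avoided, then, by the game, some stage gives a
finite set of prefixes one of which moves any given word into that colour, and
colouring words by that prefix yields a left-variable word. *)

(** * The Hales-Jewett theorem *)

Definition word k (w : seq nat) := all (gtn k) w.

(* A variable word; [None] is the variable. *)
Definition vword k (W : seq (option nat)) :=
  all (fun o => if o is Some a then a < k else true) W.

Definition fill (W : seq (option nat)) (a : nat) : seq nat := map (odflt a) W.

Lemma fill_cat V W a : fill (V ++ W) a = fill V a ++ fill W a.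
Proof. exact: map_cat. Qed.

Lemma fill_Some w a : fill (map Some w) a = w.
Proof. by rewrite /fill -map_comp map_id. Qed.

Lemma word_fill k W a : vword k W -> a < k -> word k (fill W a).
Proof.
move=> kW ak; rewrite /word all_map; apply: sub_all kW => -[b|] //=.
Qed.

Lemma vword_Some k w : vword k (map Some w) = word k w.
Proof. by rewrite /vword all_map. Qed.

Lemma vwordS k W : vword k W -> vword k.+1 W.
Proof. by apply: sub_all => -[a|] //=; lia. Qed.

Lemma wordS k w : word k w -> word k.+1 w.
Proof. by apply: sub_all => a /=; lia. Qed.

(** Puts words of bounded length into a finite type, so that functions on them can serve as
    colours. *)
Lemma word_bseq k N u : word k.+1 u -> size u <= N ->
  exists v : N.-bseq 'I_k.+1, map val v = u.
Proof.
move=> ku uN; have sz : size (map (@inord k) u) <= N by rewrite size_map.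
exists (Bseq sz); rewrite /= -map_comp -[RHS]map_id; apply/eq_in_map => x xu /=.
by rewrite inordK //; exact: (allP ku).
Qed.

(** [N] is chosen before [c], as focusing requires: tails of length at most [N] become part of the
    colours at the next step. *)
Definition hales_jewett k := forall C : finType, exists N, forall c : seq nat -> C,
  exists W, [/\ size W <= N, None \in W, vword k W &
    forall a b, a < k -> b < k -> c (fill W a) = c (fill W b)].

(** Colour a word z by the whole function sending a tail u to [c (z ++ u)]. *)
Lemma insensitive k l N (C : finType) : hales_jewett k ->
  exists M, forall c : seq nat -> C,
  exists W, [/\ size W <= M, None \in W, vword k W &
    forall a b u, a < k -> b < k -> word l.+1 u -> size u <= N ->
      c (fill W a ++ u) = c (fill W b ++ u)].
Proof.
move=> /(_ {ffun N.-bseq 'I_l.+1 -> C}) [M HM]; exists M => c.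
have [W [WM xW kW cW]] := HM (fun z => [ffun u : N.-bseq _ => c (z ++ map val u)]).
exists W; split=> // a b u ak bk lu uN; have [v <-] := word_bseq lu uN.
by have /ffunP/(_ v) := cW a b ak bk; rewrite !ffunE.
Qed.

(* Colour focusing: lines with distinct colours on the letters below k all meet
   in the word f at the letter k. *)
Lemma hales_jewettS k : hales_jewett k.+1 -> hales_jewett k.+2.
Proof.
move=> HJ C.
pose mono (c : seq nat -> C) N := exists W, [/\ size W <= N, None \in W, vword k.+2 W &
  forall a b, a < k.+2 -> b < k.+2 -> c (fill W a) = c (fill W b)].
(* Focused lines in [#|C|.+1] distinct colours cannot exist, so for this r only [mono] remains. *)
suff /(_ #|C|.+1) [N HN] : forall r, exists N, forall c : seq nat -> C, mono c N \/
    exists (S : {set C}) f, [/\ #|S| = r, size f <= N, word k.+2 f &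
      forall col, col \in S -> exists W, [/\ size W <= N, None \in W, vword k.+2 W,
        fill W k.+1 = f & forall a, a < k.+1 -> c (fill W a) = col]].
  exists N => c; case: (HN c) => // -[S [f [cS _ _ _]]].
  by have := max_card (mem S); rewrite cS ltnn.
elim=> [|r [N HN]].
  exists 0 => c; right; exists set0, [::]; split=> //; first exact: cards0.
  by move=> col; rewrite in_set0.
have [M HM] := insensitive k.+1 N C HJ.
exists (M + N) => c.
have [W [WM xW kW cW]] := HM c.
pose d u := c (fill W 0 ++ u).
have dE a u : a < k.+1 -> word k.+2 u -> size u <= N -> c (fill W a ++ u) = d u.
  by move=> ak ku uN; apply: cW.
have monoP : mono d N -> mono c (M + N).
  move=> [V [VN xV kV dV]]; exists (map Some (fill W 0) ++ V); split.
  - by rewrite size_cat !size_map leq_add.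
  - by rewrite mem_cat xV orbT.
  - rewrite /vword all_cat; apply/andP; split=> //.
    by rewrite -/(vword _ _) vword_Some; apply: word_fill => //; exact: vwordS.
  - by move=> a b ak bk; rewrite !fill_cat !fill_Some; exact: dV.
case: (HN d) => [/monoP|]; first by left.
move=> [S [f [cS fN kf HS]]].
(* If the focus has the colour of one of its lines, that line is monochromatic. Otherwise [W] is put
   in front of each line, and [W] followed by the constant word f is a line of the new colour
   [d f]. *)
have [fS|fS] := boolP (d f \in S).
  left; apply: monoP; have [V [VN xV kV Vf dV]] := HS _ fS.
  exists V; split=> //.
  suff E a : a < k.+2 -> d (fill V a) = d f by move=> a b ak bk; rewrite !E.
  by rewrite ltnS leq_eqVlt => /orP[/eqP->|/dV//]; rewrite Vf.
right; exists (d f |: S), (fill W k.+1 ++ f); split.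
- by rewrite cardsU1 fS cS.
- by rewrite size_cat size_map leq_add.
- rewrite /word all_cat; apply/andP; split=> //.
  by apply: word_fill => //; exact: vwordS.
- move=> col; rewrite in_setU1 => /orP[/eqP->|colS].
    exists (W ++ map Some f); split.
    + by rewrite size_cat size_map leq_add.
    + by rewrite mem_cat xW.
    + by rewrite /vword all_cat -!/(vword _ _) vword_Some kf vwordS.
    + by rewrite fill_cat fill_Some.
    + by move=> a ak; rewrite fill_cat fill_Some dE.
  have [V [VN xV kV Vf dV]] := HS _ colS.
  exists (W ++ V); split.
  + by rewrite size_cat leq_add.
  + by rewrite mem_cat xW.
  + by rewrite /vword all_cat -!/(vword _ _) kV vwordS.
  + by rewrite fill_cat Vf.
  + move=> a ak; rewrite fill_cat dE ?dV//; last by rewrite size_map.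
    by apply: word_fill => //; lia.
Qed.

Theorem hales_jewettP k : hales_jewett k.
Proof.
have easy n : n <= 1 -> hales_jewett n.
  move=> n1 C; exists 1 => c; exists [:: None]; split=> // a b an bn.
  by have -> : a = b by lia.
by elim: k => [|[|k] IHk]; [exact: easy|exact: easy|exact: hales_jewettS].
Qed.

(** * Left-variable words *)

Lemma first_variable (W : seq (option nat)) : None \in W -> exists p q, W = map Some p ++ None :: q.
Proof.
elim: W => // -[a|] W IHW; last by exists [::], W.
by rewrite inE /= => /IHW [p [q ->]]; exists (a :: p), q.
Qed.

(* Colour focusing again, now at the common prefix y of the lines. *)
Theorem prefix_line k (C : finType) (c : seq nat -> C) :
  exists w V, [/\ word k w, vword k V &
    forall a, a < k -> c (w ++ a :: fill V a) = c w].
Proof.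
case: k c => [|k] c; first by exists [::], [::].
pose mono (c : seq nat -> C) := exists w V, [/\ word k.+1 w, vword k.+1 V &
    forall a, a < k.+1 -> c (w ++ a :: fill V a) = c w].
suff /(_ #|C|.+1) [N HN] : forall r, exists N, forall c : seq nat -> C, mono c \/
    exists (S : {set C}) y, [/\ #|S| = r, size y <= N, word k.+1 y &
      forall col, col \in S -> exists V, [/\ size y + (size V).+1 <= N, vword k.+1 V &
        forall a, a < k.+1 -> c (y ++ a :: fill V a) = col]].
  case: (HN c) => // -[S [y [cS _ _ _]]].
  by have := max_card (mem S); rewrite cS ltnn.
move=> {c}; elim=> [|r [N HN]].
  exists 0 => c; right; exists set0, [::]; split=> //; first exact: cards0.
  by move=> col; rewrite in_set0.
have [M HM] := insensitive k N C (hales_jewettP k.+1).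
exists (M + N) => c.
(* The constant part p of [W] before its first variable becomes the new focus; the rest q is
   absorbed into the lines that start there. *)
have [W [WM /first_variable [p [q Wpq]] kW cW]] := HM c.
pose d u := c (fill W 0 ++ u).
have dE a u : a < k.+1 -> word k.+1 u -> size u <= N ->
    c (p ++ a :: fill q a ++ u) = d u.
  move=> ak ku uN; rewrite /d -(cW a 0) // Wpq fill_cat fill_Some /=.
  by rewrite -catA.
have [kp kq] : word k.+1 p /\ vword k.+1 q.
  by move: kW; rewrite Wpq /vword all_cat /= -!/(vword _ _) vword_Some => /andP.
have Mpq : size p + (size q).+1 <= M.
  by move: WM; rewrite Wpq size_cat size_map.
have monoP : mono d -> mono c.
  move=> [w [V [kw kV dV]]]; exists (fill W 0 ++ w), V; split=> //.
    by rewrite /word all_cat; apply/andP; split=> //; exact: word_fill.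
  by move=> a ak; rewrite -catA; exact: dV.
case: (HN d) => [/monoP|]; first by left.
move=> [S [y [cS yN ky HS]]].
(* If y has a focused colour, the line of that colour agrees with its own prefix y. Otherwise the
   words p a q y form a line of the new colour [d y], and the words p a q y a V keep the old
   colours. *)
have [yS|yS] := boolP (d y \in S).
  left; apply: monoP; have [V [_ kV dV]] := HS _ yS.
  by exists y, V.
right; exists (d y |: S), p; split=> //.
- by rewrite cardsU1 yS cS.
- lia.
- move=> col; rewrite in_setU1 => /orP[/eqP->|colS].
    exists (q ++ map Some y); split.
    + by rewrite size_cat size_map; lia.
    + by rewrite /vword all_cat -!/(vword _ _) vword_Some kq.
    + by move=> a ak; rewrite fill_cat fill_Some dE.
  have [V [VN kV dV]] := HS _ colS.
  exists (q ++ map Some y ++ None :: V); split.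
  + by rewrite !size_cat size_map /=; lia.
  + by rewrite /vword !all_cat /= -!/(vword _ _) vword_Some kq kV /= andbT.
  + move=> a ak; rewrite !fill_cat fill_Some /= dE ?dV//.
      by rewrite /word all_cat /= ak -!/(word _ _) ky word_fill.
    by rewrite size_cat /= size_map.
Qed.

From mathcomp Require Import finmap.
From mathcomp Require Import boolp classical_sets functions cardinality.

Local Open Scope classical_set_scope.

(** * Rigid surjections *)

Definition rigid (f : nat -> nat) :=
  (forall k, exists x, f x = k) /\ (forall x j, j < f x -> exists2 y, y < x & f y = j).

(** The segment of f cut off at n has exactly k blocks. *)
Definition onto k n (f : nat -> nat) :=
  (forall x, x < n -> f x < k) /\ (forall j, j < k -> exists2 x, x < n & f x = j).

(* The order of the sets (s, X)^omega, for s an initial segment with k blocks. *)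
Definition below k (g f : nat -> nat) :=
  exists2 h : nat -> nat, forall i, i < k -> h i = i & g = h \o f.

(** For a < j, block j joins block a and later blocks move down by one. The map [bump j], which
    skips j, is a section. *)
Definition collapse j a i := if i < j then i else if i == j then a else i.-1.

Lemma rigid_first f k : rigid f -> exists2 n, f n = k & onto k n f.
Proof.
move=> [sf rf]; have ex : exists n, f n == k by have [n <-] := sf k; exists n.
case: (ex_minnP ex) => n /eqP fn nmin; exists n => //; split=> [x xn|j jk].
  rewrite ltnNge; apply/negP => kx.
  have [fx|fx] := eqVneq (f x) k; first by have := nmin x; rewrite fx eqxx; lia.
  have [|y yx fy] := rf x k; first by lia.
  by have := nmin y; rewrite fy eqxx; lia.
by have [|y yn fy] := rf n j; [rewrite fn|exists y].
Qed.

Lemma rigid_le f x : rigid f -> f x <= x.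
Proof.
move=> [_ rf]; elim/ltn_ind: x => x IHx; rewrite leqNgt; apply/negP => xf.
have [y yx fy] := rf x x xf; have := IHx y yx; lia.
Qed.

Lemma rigid_factor h f : rigid f -> rigid (h \o f) -> rigid h.
Proof.
move=> rf [shf rhf]; split=> [k|i j ji].
  by have [x <-] := shf k; exists (f x).
have [x fx [px _]] := rigid_first i rf.
have [|y yx <-] := rhf x j; first by rewrite /= fx.
by exists (f y) => //; exact: px.
Qed.

Lemma below_refl k f : below k f f. Proof. by exists id. Qed.

Lemma below_trans k g f e : below k g f -> below k f e -> below k g e.
Proof.
move=> [h hk ->] [h' h'k ->]; exists (h \o h') => // i ik /=.
by rewrite h'k ?hk.
Qed.

Lemma below_mono k l g f : k <= l -> below l g f -> below k g f.
Proof. by move=> kl [h hl ->]; exists h => // i ik; apply: hl; lia. Qed.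

Lemma below_collapse j a f : below j (collapse j a \o f) f.
Proof. by exists (collapse j a) => // i ij; rewrite /collapse ij. Qed.

Ltac collapse_lia := rewrite /collapse /bump; repeat case: ifP; lia.

(** [bump j] undoes the renumbering, and j is sent to a, where h has the same value. This peels one
    merge off a coarsening h. *)
Lemma collapse_bump j a (h : nat -> nat) : a < j -> h j = h a -> h \o bump j \o collapse j a = h.
Proof.
move=> aj ha; apply/funext => i /=.
have [->|ij] := eqVneq i j.
  by rewrite [RHS]ha /collapse ltnn eqxx; congr h; rewrite /bump; lia.
by congr h; collapse_lia.
Qed.

(** The merge uses up one frozen block; the new factor is h conjugated by the merge and its
    section. *)
Lemma below_collapse2 k j a g f : j <= k -> a < j -> below k.+1 g f ->
  below k (collapse j a \o g) (collapse j a \o f).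
Proof.
move=> jk aj [h hk ->]; exists (collapse j a \o h \o bump j) => [i ik /=|].
  by rewrite hk; collapse_lia.
by rewrite [LHS]compA -{1}(@collapse_bump j a (collapse j a \o h)) //= !hk; collapse_lia.
Qed.

Lemma rigid_comp h f : rigid h -> rigid f -> rigid (h \o f).
Proof.
move=> [sh rh] [sf rf]; split=> [k|x j /rh [i /rf [y yx <-] <-]]; last by exists y.
by have [i <-] := sh k; have [x <-] := sf i; exists x.
Qed.

Lemma rigid_collapse j a : a < j -> rigid (collapse j a).
Proof.
move=> aj; split=> [k|x i ix]; first by exists (bump j k); collapse_lia.
by exists (bump j i); move: ix; collapse_lia.
Qed.

(* The unfrozen letters of h are renamed so that no letter becomes j. *)
Lemma lift_collapse k j a g f : j <= k -> a < j -> rigid f -> rigid g ->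
  below k g (collapse j a \o f) ->
  exists g', [/\ rigid g', below k.+1 g' f & g = collapse j a \o g'].
Proof.
move=> jk aj rf rg [h hk gE].
have [sh rh] : rigid h.
  by apply: (@rigid_factor h (collapse j a \o f)); [exact/rigid_comp/rf/rigid_collapse|rewrite -gE].
pose h' i := if i <= k then i else if h i.-1 < j then h i.-1 else (h i.-1).+1.
have h'S v i : k <= v -> h i = v -> h' i.+1 = v.+1.
  move=> kv hi; have ki : k <= i.
    by rewrite leqNgt; apply/negP => ik; move: hi; rewrite hk; lia.
  by rewrite /h' /= hi; do ![case: ifP]; lia.
have rh' : rigid h'.
  split=> [v|x v].
    have [vk|kv] := leqP v k; first by exists v; rewrite /h' vk.
    by have [i hi] := sh v.-1; exists i.+1; rewrite (h'S v.-1); lia.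
  have [xk|kx] := leqP x k; first by rewrite {1}/h' xk => vx; exists v => //; rewrite /h'; case: ifP; lia.
  have [vk|kv] := leqP v k; first by exists v; [lia|rewrite /h' vk].
  rewrite {1}/h' (leqNgt x k) kx /= => vx; have [|y yx hy] := rh x.-1 v.-1.
    by move: vx; case: ifP; lia.
  by exists y.+1; [lia|rewrite (h'S v.-1); lia].
exists (h' \o f); split; first exact: rigid_comp.
  by exists h' => // i; rewrite ltnS /h' => ->.
rewrite gE compA [RHS]compA; congr (_ \o _); apply/funext => i /=; rewrite /h'.
have [ik|ik] := leqP i k.
  by have sk : collapse j a i < k by [collapse_lia]; rewrite (hk _ sk).
by have -> : collapse j a i = i.-1 by [collapse_lia]; collapse_lia.
Qed.

(** * Words acting on surjections *)

Lemma collapse_comm l j a b : l <= j -> a < l -> b < l ->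
  collapse l b \o collapse j.+1 a = collapse j a \o collapse l b.
Proof. by move=> lj al bl; apply/funext => i /=; collapse_lia. Qed.

(** What is attached to block l follows it into a: block l plays the variable, and a is substituted
    for it. *)
Lemma collapse_comm_var l a : a < l -> collapse l a \o collapse l.+1 l = collapse l a \o collapse l a.
Proof. by move=> al; apply/funext => i /=; collapse_lia. Qed.

(** Each letter a sends the first unfrozen block to block a; the next block then gets the number
    k. *)
Fixpoint act_word k (w : seq nat) (f : nat -> nat) :=
  if w is a :: w' then act_word k w' (collapse k a \o f) else f.

Lemma act_word_cat k v w f : act_word k (v ++ w) f = act_word k w (act_word k v f).
Proof. by elim: v f => //= a v IHv f. Qed.

Lemma act_word_rcons k w a f : word k w -> a < k ->
  act_word k (rcons w a) f = act_word k w (collapse (k + size w) a \o f).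
Proof.
elim: w f => [|b w IHw] f /=; first by rewrite addn0.
move=> /andP[bk kw] ak; rewrite IHw // addnS compA [in RHS]compA.
by rewrite (@collapse_comm k (k + size w)) // leq_addr.
Qed.

(** The letters of w lie below k, so its merges, made at the blocks from [k + size v] on, can be
    postponed until v has acted. *)
Lemma act_word_shift k v w f : word k v -> word k w ->
  act_word k v (act_word (k + size v) w f) = act_word k (v ++ w) f.
Proof.
move=> kv; elim: w f => [|a w IHw] f /=; first by rewrite cats0.
move=> /andP[ak kw]; rewrite IHw // -cat_rcons !act_word_cat; congr act_word.
by rewrite act_word_rcons.
Qed.

(** Filling with k attaches the variable positions to block k; merging that block into a afterwards
    amounts to filling with a. This carries lines of words over to surjections. *)
Lemma act_word_var k V a f : vword k V -> a < k ->
  collapse k a \o act_word k.+1 (fill V k) f = act_word k (fill V a) (collapse k a \o f).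
Proof.
move=> kV ak; elim: V f kV => //= -[b|] V IHV f /= => [/andP[bk kV]|kV].
  by rewrite IHV // compA collapse_comm.
by rewrite IHV // compA collapse_comm_var.
Qed.

Lemma below_act_word k w f : below k (act_word k w f) f.
Proof.
elim: w f => [|a w IHw] f /=; first exact: below_refl.
exact: below_trans (IHw _) (below_collapse _ _ _).
Qed.

Lemma below_act_word2 k l w g f : word k w -> k <= l -> below (l + size w) g f ->
  below l (act_word k w g) (act_word k w f).
Proof.
elim: w l g f => [|a w IHw] l g f /=; first by rewrite addn0.
move=> /andP[ak kw] kl gf; apply: IHw => //; apply: below_collapse2 => //; last by rewrite -addnS.
by apply: leq_trans kl _; rewrite leq_addr.
Qed.

(** * Fusion and the pigeonhole principle *)

(** The coarsenings settled by stage n of a fusion: g and the results of merging blocks numbered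
    from k up to k + n - 1. Each merge lowers the number of frozen blocks, at which [Q] is taken, by
    one. *)
Fixpoint after_collapses (Q : nat -> set (nat -> nat)) k n g : Prop :=
  if n is m.+1 then Q (k + m.+1) g /\
    forall j a, k <= j <= k + m -> a < j -> after_collapses Q k m (collapse j a \o g)
  else Q k g.

Section GameFamily.

Context (U : set (nat -> nat)).
Context (U_rigid : forall f, U f -> rigid f).
Context (U_collapse : forall j a f, U f -> a < j -> U (collapse j a \o f)).
Context (U_refine : forall h f, rigid f -> U (h \o f) -> U f).
(* What the absence of a winning strategy for II amounts to: an invariant J that
   II can always carry to the next stage holds in the limit of some play. *)
Context (U_game : forall k f (J : nat -> set (nat -> nat)), U f ->
  (forall n g g', U g -> U g' -> below k g f -> below (k + n) g' g -> J n g -> J n g') ->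
  J 0 f ->
  (forall n g, U g -> below k g f -> J n g ->
    exists g', [/\ U g', below (k + n) g' g & J n.+1 g']) ->
  exists g, [/\ U g, below k g f & forall n, J n g]).

Lemma U_act_word k w f : word k w -> U f -> U (act_word k w f).
Proof.
elim: w f => //= a w IHw f /andP[ak kw] Uf; apply: IHw => //.
exact: U_collapse.
Qed.

Lemma below_U_rigid k g f : U f -> U g -> below k g f ->
  exists h, [/\ rigid h, forall i, i < k -> h i = i & g = h \o f].
Proof.
move=> Uf Ug [h hk gE]; exists h; split=> //.
by apply: rigid_factor (U_rigid Uf) _; rewrite -gE; exact: U_rigid.
Qed.

(** The game is played with [after_collapses Q K] as invariant. Any z below the limit arises from it
    by finitely many merges followed by a coarsening that fixes k blocks, so [Qdown] applies. *)
Lemma fusion K f (Q : nat -> set (nat -> nat)) : U f ->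
  (forall k g g', K <= k -> U g -> U g' -> below K g f -> below k g' g -> Q k g -> Q k g') ->
  (forall k g, K <= k -> U g -> below K g f -> exists g', [/\ U g', below k g' g & Q k g']) ->
  exists g, [/\ U g, below K g f &
    forall k z, K <= k -> U z -> below K z g -> Q k z].
Proof.
move=> Uf Qdown Qdense.
pose Qall := after_collapses Q K.
have below_collapse_f j a g : K <= j -> below K g f -> below K (collapse j a \o g) f.
  by move=> Kj gf; apply: below_trans gf; apply: below_mono Kj _; exact: below_collapse.
have QallD n g g' : U g -> U g' -> below K g f -> below (K + n) g' g -> Qall n g -> Qall n g'.
  elim: n g g' => [|n IHn] g g' Ug Ug' gf g'g /=.
    by apply: Qdown => //; rewrite -[K]addn0.
  move=> [Qg Hg]; split; first by apply: Qdown Qg => //; exact: leq_addr.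
  move=> j a Kj aj; apply: (IHn (collapse j a \o g)); [exact: U_collapse|exact: U_collapse| | |exact: Hg].
    by apply: below_collapse_f => //; lia.
  by apply: below_collapse2 => //; [lia|rewrite -addnS].
have Qall_dense n : forall g, U g -> below K g f ->
    exists g', [/\ U g', below (K + n) g' g & Qall n g'].
  elim: n => [|n IHn] g Ug gf /=; first by rewrite addn0; exact: Qdense.
  have [|g1 [Ug1 g1g Qg1]] := Qdense (K + n.+1) g _ Ug gf; first exact: leq_addr.
  have g1f : below K g1 f by apply: below_trans gf; apply: below_mono g1g; exact: leq_addr.
  (* The merges are settled one at a time: a good coarsening of the merged map is lifted to one of
     [g2], and [QallD] preserves the merges settled before. *)
  have step (l : seq (nat * nat)) : exists g2, [/\ U g2, below (K + n.+1) g2 g1 &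
      forall j a, (j, a) \in l -> K <= j <= K + n -> a < j -> Qall n (collapse j a \o g2)].
    elim: l => [|[j a] l [g2 [Ug2 g21 Hg2]]]; first by exists g1; split=> //; exact: below_refl.
    have [/andP[Kj aj]|nj] := boolP ((K <= j <= K + n) && (a < j)); last first.
      exists g2; split=> // j' a'; rewrite inE => /orP[/eqP[-> ->]|]; last exact: Hg2.
      by move=> h1 h2; move: nj; rewrite h1 h2.
    have g2f : below K g2 f by apply: below_trans g1f; apply: below_mono g21; exact: leq_addr.
    have [||h [Uh hg2 Qh]] := IHn (collapse j a \o g2).
    - exact: U_collapse.
    - by apply: below_collapse_f => //; lia.
    have [||||g3 [rg3 g32 hE]] := @lift_collapse (K + n) j a h g2 _ _ _ _ hg2 => //.
    - lia.
    - exact: U_rigid.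
    - exact: U_rigid.
    have Ug3 : U g3 by apply: (@U_refine (collapse j a)); rewrite -?hE.
    rewrite -addnS in g32.
    exists g3; split=> //; first exact: below_trans g32 g21.
    move=> j' a'; rewrite inE => /orP[/eqP[-> ->] _ _|jl Kj' aj']; first by rewrite -hE.
    apply: (QallD n (collapse j' a' \o g2)); [exact: U_collapse|exact: U_collapse| | |exact: Hg2].
      by apply: below_collapse_f => //; lia.
    by apply: below_collapse2 => //; [lia|rewrite -addnS].
  have [g2 [Ug2 g21 Hg2]] :=
    step [seq (j, a) | j <- iota 0 (K + n).+1, a <- iota 0 (K + n).+1].
  exists g2; split=> //; first exact: below_trans g21 g1g.
  split; first by apply: Qdown Qg1 => //; exact: leq_addr.
  move=> j a Kj aj; apply: Hg2 => //.
  by apply: allpairs_f; rewrite mem_iota; lia.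
have [g0 [Ug0 g0f Qg0]] := Qall_dense 0 f Uf (below_refl _ _); rewrite addn0 in g0f.
have [|||g [Ug gg0 Qg]] := @U_game K g0 Qall Ug0.
- move=> n h h' Uh Uh' hg0; apply: QallD => //; exact: below_trans hg0 g0f.
- exact: Qg0.
- move=> n h Uh hg0 _; have [h' [Uh' h'h Qh']] := Qall_dense n.+1 h Uh (below_trans hg0 g0f).
  by exists h'; split=> //; apply: below_mono h'h; lia.
have gf := below_trans gg0 g0f.
exists g; split=> // k z Kk Uz zg; have [h [rh hK zE]] := below_U_rigid Ug Uz zg.
(* h maps the blocks below [M] onto those below k; the induction on [M - K] peels off one merge at a
   time. *)
have [M hM preM] := rigid_first k rh.
have KM : K <= M by rewrite leqNgt; apply/negP => MK; have := hK M MK; lia.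
have : Qall (M - K) g by [].
have : onto k (K + (M - K)) h by rewrite subnKC.
move: (M - K) => n; rewrite zE in Uz * => {Qg gg0 M hM preM KM zE zg z}.
elim: n g h Ug Uz gf rh hK => [|n IHn] g h Ug Uhg gf rh hK [hlt hsur].
  move=> Qg; have kK : k = K.
    apply/eqP; rewrite eqn_leq Kk andbT leqNgt; apply/negP => Kk'.
    by have [x xK hx] := hsur K Kk'; move: (hK x); rewrite hx; lia.
  by rewrite kK; apply: Qdown Qg => //; exists h.
move=> [Qg Hg].
have [fix_h|] := pselect (forall i, i < K + n.+1 -> h i = i).
  have -> : k = K + n.+1.
    apply/eqP; rewrite eqn_leq; apply/andP; split; rewrite leqNgt; apply/negP => lt.
      by have [x xn hx] := hsur _ lt; move: (fix_h x xn); lia.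
    by have := hlt k lt; rewrite fix_h //; lia.
  by apply: Qdown Qg => //; [exact: leq_addr|exists h].
move=> /existsNP nfix.
have ex : exists j, h j != j by have [j /not_implyP[_ /eqP hj]] := nfix; exists j.
(* By rigidity the least block j moved by h goes to an earlier one, so h factors through the merge
   of j into [h j]. *)
case: (ex_minnP ex) => j /eqP hj jmin.
have fixj i : i < j -> h i = i.
  by move=> ij; apply/eqP; apply: contraLR ij; rewrite -leqNgt; exact: jmin.
have jn : j <= K + n.
  have [i /not_implyP[iK /eqP/jmin]] := nfix; lia.
have Kj : K <= j by rewrite leqNgt; apply/negP => /hK.
have aj : h j < j by have := rigid_le j rh; lia.
have hE : h = h \o bump j \o collapse j (h j) by rewrite collapse_bump // [RHS]fixj.
have bumpj i : i < j -> bump j i = i by rewrite /bump; lia.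
rewrite {1}hE -compA; apply: IHn.
- exact: U_collapse.
- by rewrite compA -hE.
- by apply: below_trans gf; apply: below_mono Kj _; exact: below_collapse.
- by apply: rigid_factor (rigid_collapse aj) _; rewrite -hE.
- by move=> i iK /=; rewrite bumpj ?hK // (leq_trans iK).
- split=> [i iK /=|l /hsur [i iK <-]]; first by apply: hlt; rewrite /bump; lia.
  have [->|ij] := eqVneq i j.
    by exists (h j); [lia|rewrite /= bumpj // [LHS]fixj].
  exists (collapse j 0 i); first by collapse_lia.
  by rewrite /=; congr h; collapse_lia.
- by apply: Hg => //; rewrite Kj.
Qed.

(** A colour of the one-block-longer extensions of (k, e): once block k is frozen too, coarsening no
    longer changes it. *)
Definition block_invariant (B : set (nat -> nat)) k e := forall g g', U g -> U g' ->
  below k g e -> below k.+1 g' g -> (B g <-> B g').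

Definition large (B : set (nat -> nat)) k e := forall g, U g -> below k g e ->
  exists z, [/\ U z, below k z g & B z].

Lemma block_invariantC B k e : block_invariant B k e -> block_invariant (~` B) k e.
Proof. by move=> iB g g' Ug Ug' ge g'g; rewrite /setC /= (iB g g'). Qed.

Lemma block_invariant_below B k e f : below k f e -> block_invariant B k e -> block_invariant B k f.
Proof. by move=> fe iB g g' Ug Ug' gf; apply: iB => //; exact: below_trans fe. Qed.

(** A word of length n absorbs the blocks k, ..., k + n - 1 of z, and block k + n becomes the new
    block k. *)
Definition instances (B : set (nat -> nat)) k n : set (nat -> nat) :=
  [set z | forall w, size w = n -> word k w -> B (act_word k w z)].

Lemma instances_below B k n f g g' : block_invariant B k f -> U g -> U g' -> below k g f ->
  below (k + n).+1 g' g -> (instances B k n g <-> instances B k n g').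
Proof.
move=> iB Ug Ug' gf g'g; split=> H w sw kw.
all: have wg : below k (act_word k w g) f by exact: below_trans (below_act_word _ _ _) gf.
all: have g'gw : below k.+1 (act_word k w g') (act_word k w g) by
  apply: below_act_word2 => //; rewrite sw addSn.
all: have [BB' B'B] := iB _ _ (U_act_word kw Ug) (U_act_word kw Ug') wg g'gw.
  by apply: BB'; exact: H.
by apply: B'B; exact: H.
Qed.

(* A refinement of g by h assigns a word to the blocks of g that precede its
   first new block. *)
Lemma block_invariant_all B k f g : block_invariant B k f -> U g -> below k g f ->
  (forall n, instances B k n g) -> forall z, U z -> below k z g -> B z.
Proof.
move=> iB Ug gf Hg z Uz zg; have [h [rh hK zE]] := below_U_rigid Ug Uz zg.
have [M hM [preM _]] := rigid_first k rh.
have kM : k <= M by rewrite leqNgt; apply/negP => Mk; have := hK M Mk; lia.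
move: (Hg (M - k)) preM hM; rewrite -{2 3}(subnKC kM).
rewrite zE in Uz * => {Hg kM zE zg z}.
elim: (M - k) g h Ug Uz gf rh hK => [|n IHn] g h Ug Uz gf rh hK Hg hlt hM.
  rewrite addn0 in hM; apply/(iB g _ Ug Uz gf); last exact: (Hg [::]).
  by exists h => // i; rewrite ltnS leq_eqVlt => /orP[/eqP->|/hK].
have aK : h k < k by apply: hlt; lia.
(* The first letter of the word is [h k]; after this merge the remaining word is one shorter. *)
have hE : h = h \o bump k \o collapse k (h k) by rewrite collapse_bump // [RHS]hK.
have bumpk i : i < k -> bump k i = i by rewrite /bump; lia.
rewrite hE -compA; apply: IHn.
- exact: U_collapse.
- by rewrite compA -hE.
- by apply: below_trans gf; exact: below_collapse.
- by apply: rigid_factor (rigid_collapse aK) _; rewrite -hE.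
- by move=> i ik /=; rewrite bumpk ?hK.
- by move=> w sw kw; apply: (Hg (h k :: w)); rewrite /= ?sw ?aK.
- by move=> i ik /=; apply: hlt; rewrite /bump; lia.
- by rewrite /= -[RHS]hM; congr h; rewrite /bump; lia.
Qed.

Lemma large_below B k f g : below k g f -> large B k f -> large B k g.
Proof. by move=> gf lB h Uh hg; apply: lB => //; exact: below_trans gf. Qed.

(* Otherwise fusion yields y below f with no z in B all of whose substitution
   instances are in B. As B is large below y, player II cannot avoid B forever
   below y: from some stage on each word over k has, after one of finitely many
   prefixes e, an instance in B. Colouring words by e contradicts [prefix_line]. *)
Lemma large_step B k f : U f -> block_invariant B k f -> large B k f ->
  exists z, [/\ U z, below k z f, B z &
    large [set z' | forall a, a < k -> B (collapse k a \o z')] k.+1 z].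
Proof.
move=> Uf iB lB; set B' := [set z' | _]; apply: contrapT => none.
(* The condition is about level [k.+1]; at other levels [Q] holds trivially. *)
pose Q j : set (nat -> nat) := [set z | j = k.+1 -> B z ->
  forall z', U z' -> below k.+1 z' z -> ~ B' z'].
have [||y [Uy yf Qy]] := @fusion k f Q Uf.
- move=> j g g' kj Ug Ug' gf g'g Qg jk; rewrite jk in g'g => Bg' z' Uz' z'g'.
  by apply: Qg => //; [apply/(iB g g')|exact: below_trans g'g].
- move=> j g kj Ug gf.
  have [jk|jk] := eqVneq j k.+1; last first.
    by exists g; split=> //; [exact: below_refl|move=> jk'; rewrite jk' eqxx in jk].
  have [Bg|nBg] := pselect (B g); last by exists g; split=> //; exact: below_refl.
  have : ~ large B' k.+1 g by move=> lg; apply: none; exists g.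
  move=> /existsNP [g' /not_implyP[Ug' /not_implyP[g'g ng']]].
  exists g'; rewrite jk; split=> // _ _ z' Uz' z'g' Bz'; apply: ng'.
  by exists z'.
have {none Qy} noline z : U z -> below k z y -> B z -> ~ B' z.
  by move=> Uz zy Bz; apply: (Qy k.+1 z) => //; exact: below_refl.
(* All instances are to be kept out of [B]. If every stage succeeded, [block_invariant_all] would
   make the limit avoid [B], against largeness. *)
pose J n : set (nat -> nat) := [set z | forall m, m < n -> instances (~` B) k m z].
have iB' : block_invariant (~` B) k y by apply: block_invariantC; exact: block_invariant_below iB.
have JD n g g' : U g -> U g' -> below k g y -> below (k + n) g' g -> J n g -> J n g'.
  move=> Ug Ug' gy g'g Jg m mn; apply/(instances_below iB' Ug Ug' gy _).1; last exact: Jg.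
  by apply: below_mono g'g; rewrite -addnS leq_add2l.
have [n [z [Uz zy Jz stuck]]] : exists n z, [/\ U z, below k z y, J n z &
    forall z', U z' -> below (k + n) z' z -> ~ J n.+1 z'].
  apply: contrapT => nstuck; have [||g [Ug gy Jg]] := @U_game k y J Uy JD.
  - by [].
  - move=> n g Ug gy Jg; apply: contrapT => ng; apply: nstuck; exists n, g; split=> //.
    by move=> z' Uz' z'g Jz'; apply: ng; exists z'.
  - have [z [Uz zg Bz]] := lB g Ug (below_trans gy yf).
    by apply: (block_invariant_all iB' Ug gy _ Uz zg) => // n; exact: (Jg n.+1).
(* The word w acts on the blocks from k + n on, which are still free. The alphabet ['I_k.+1] is
   inhabited even for k = 0, which gives a value when w is not a word over k. *)
have col w : exists e : n.-tuple 'I_k.+1, word k w ->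
    word k (map val e) /\ B (act_word k (map val e ++ w) z).
  have [kw|] := boolP (word k w); last by exists [tuple ord0 | _ < n].
  have Uw : U (act_word (k + n) w z).
    by apply: U_act_word => //; apply: sub_all kw => a /= ak; apply: leq_trans ak _; exact: leq_addr.
  have /existsNP [m /not_implyP[mn]] := stuck _ Uw (below_act_word _ _ _).
  move=> /existsNP [e /not_implyP[se /not_implyP[ke /contrapT Be]]].
  have mE : m = n.
    apply/eqP; rewrite eqn_leq -ltnS mn leqNgt; apply/negP => mn'.
    by apply: (JD n z _ Uz Uw zy (below_act_word _ _ _) Jz m mn' e).
  rewrite mE in se; have [e' e'E] := word_bseq (wordS ke) (eq_leq se).
  have se' : size e' == n by apply/eqP; rewrite -[RHS]se -e'E size_map.
  exists (Tuple se') => _; rewrite /= e'E; split=> //.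
  by rewrite -act_word_shift ?se.
have [c Hc] := choice col.
have [w [V [kw kV cV]]] := prefix_line k c.
set e := map val (c w) in cV *.
have [ke Be] := Hc w kw.
have kew : word k (e ++ w) by rewrite /word all_cat; apply/andP.
set u := act_word k (e ++ w) z.
have Uu : U u by exact: U_act_word.
have uy : below k u y by apply: below_trans zy; exact: below_act_word.
have uf := below_trans uy yf.
(* Block k is the variable of the line: with it frozen the map stays in [B] by invariance, and
   merging it into a gives the instance at [w ++ a :: fill V a], which has the same prefix e. *)
have Uv : U (act_word k.+1 (fill V k) u).
  by apply: U_act_word => //; apply: word_fill => //; exact: vwordS.
have vu : below k.+1 (act_word k.+1 (fill V k) u) u by exact: below_act_word.
apply: (noline _ Uv).
- by apply: below_trans uy; apply: below_mono vu.
- by apply/(iB u _ Uu Uv uf vu).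
- move=> a ak; rewrite act_word_var //.
  have : word k (w ++ a :: fill V a).
    by rewrite /word all_cat /= ak -!/(word _ _) kw word_fill.
  by move=> /Hc[_]; rewrite cV // -/e catA act_word_cat.
Qed.

(* The Carlson-Simpson theorem inside U. *)
Lemma pigeonhole B k f : U f -> block_invariant B k f -> exists y, [/\ U y, below k y f &
  (forall z, U z -> below k z y -> B z) \/ (forall z, U z -> below k z y -> ~ B z)].
Proof.
move=> Uf iB; have [lB|] := pselect (large B k f); last first.
  move=> /existsNP [y /not_implyP[Uy /not_implyP[yf ny]]].
  by exists y; split=> //; right=> z Uz zy Bz; apply: ny; exists z.
(* Largeness for length n keeps the play going; the shorter lengths are already secured for the
   limit. *)
pose J n : set (nat -> nat) := [set z |
  large (instances B k n) (k + n) z /\ forall m, m < n -> instances B k m z].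
have [|||y [Uy yf Jy]] := @U_game k f J Uf.
- move=> n g g' Ug Ug' gf g'g [lg Ig]; split; first exact: large_below lg.
  move=> m mn; apply/(instances_below iB Ug Ug' gf _).1; last exact: Ig.
  by apply: below_mono g'g; rewrite -addnS leq_add2l.
- split=> //; rewrite addn0 => g Ug gf; have [z [Uz zg Bz]] := lB g Ug gf.
  by exists z; split=> // w /size0nil ->.
- move=> n g Ug gf [lg Ig].
  have iI : block_invariant (instances B k n) (k + n) g.
    move=> h h' Uh Uh' hg h'h; apply: (instances_below iB Uh Uh' _ h'h).
    by apply: below_trans gf; apply: below_mono hg; exact: leq_addr.
  have [z [Uz zg Bz lz]] := large_step Ug iI lg.
  exists z; split=> //; split.
    rewrite addnS => h Uh hz; have [z' [Uz' z'h Bz']] := lz h Uh hz.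
    exists z'; split=> // w; case/lastP: w => // w a; rewrite size_rcons => -[sw].
    rewrite /word all_rcons => /andP[ak kw]; rewrite act_word_rcons // sw.
    by apply: Bz' => //; apply: leq_trans ak _; exact: leq_addr.
  move=> m; rewrite ltnS leq_eqVlt => /orP[/eqP->//|mn].
  apply/(instances_below iB Ug Uz gf _).1; last exact: Ig.
  by apply: below_mono zg; rewrite -addnS leq_add2l.
exists y; split=> //; left; apply: block_invariant_all yf _ => // n.
exact: (Jy n.+1).2.
Qed.

Lemma decision (D : nat -> set (nat -> nat)) :
  (forall k l g g', U g -> U g' -> k <= l -> below k g' g -> D k g -> D l g') ->
  (forall k g, U g -> (forall g', U g' -> below k g' g -> D k.+1 g') -> D k g) ->
  forall K f, U f -> exists g, [/\ U g, below K g f & D K g \/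
    forall k z, K <= k -> U z -> below K z g -> ~ D k z].
Proof.
move=> Ddown Dstep K f Uf.
have [||y [Uy yf Hy]] := @fusion K f (fun k => [set z |
    D k z \/ forall z', U z' -> below k z' z -> ~ D k z']) Uf.
- move=> k g g' _ Ug Ug' _ g'g [Dg|Rg]; first by left; exact: Ddown Dg.
  by right=> z' Uz' z'g'; apply: Rg => //; exact: below_trans g'g.
- move=> k g _ Ug _.
  have [[g' [Ug' g'g Dg']]|nD] := pselect (exists g', [/\ U g', below k g' g & D k g']).
    by exists g'; split=> //; left.
  exists g; split=> //; first exact: below_refl.
  by right=> z' Uz' z'g Dz'; apply: nD; exists z'.
have [||x [Ux xy Hx]] := @fusion K y (fun k => [set z |
    D k z \/ forall z', U z' -> below k z' z -> ~ D k.+1 z']) Uy.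
- move=> k g g' _ Ug Ug' _ g'g [Dg|Rg]; first by left; exact: Ddown Dg.
  by right=> z' Uz' z'g'; apply: Rg => //; exact: below_trans g'g.
- move=> k g Kk Ug gy.
  have iD : block_invariant (D k.+1) k g.
    move=> h h' Uh Uh' hg h'h; split; first exact: Ddown.
    move=> Dh'; have hy : below K h y by apply: below_trans gy; exact: below_mono hg.
    have [//|Rh] := Hy k.+1 h (leqW Kk) Uh hy.
    by case: (Rh h' Uh' h'h).
  have [z [Uz zg [Dz|Rz]]] := pigeonhole Ug iD; exists z; split=> //.
    by left; exact: Dstep.
  by right.
exists x; split=> //; first exact: below_trans yf.
have [Dx|nDx] := pselect (D K x); [by left|right].
move=> k z /subnKC <-; elim: (k - K) z => [|n IHn] z Uz zx.
  rewrite addn0; have [//|] := Hy K x (leqnn _) Ux xy.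
  by apply.
have := Hx (K + n) z (leq_addr _ _) Uz zx; rewrite addnS => -[/IHn []//|].
by apply=> //; exact: below_refl.
Qed.

End GameFamily.

(** * Partitions as rigid surjections *)

(** Through this relation [coarser] becomes inclusion and [initial] restriction of equivalence
    relations. *)
Definition same_block (X : blocks) x y := exists2 b, X b & b x /\ b y.

Definition blocks_of (f : nat -> nat) : blocks := [set b | exists i, b = f @^-1` [set i]].

Definition segment_of (f : nat -> nat) n : blocks :=
  [set b | exists2 x, x < n & b = [set y | y < n /\ f y = f x]].

Lemma dom_partition (X : blocks) D : classical_sets.partition X id D -> dom X = D.
Proof. by case. Qed.

Lemma block_unique (X : blocks) b c x : trivIset X id -> X b -> X c -> b x -> c x -> b = c.
Proof. by move=> tX Xb Xc bx cx; apply: tX => //; exists x. Qed.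

Lemma same_block_refl (X : blocks) D x : classical_sets.partition X id D -> D x -> same_block X x x.
Proof. by move=> [<- _ _] [b Xb bx]; exists b. Qed.

Lemma same_block_sym (X : blocks) x y : same_block X x y -> same_block X y x.
Proof. by move=> [b Xb [bx By]]; exists b. Qed.

Lemma same_block_trans (X : blocks) x y z : trivIset X id -> same_block X x y -> same_block X y z -> same_block X x z.
Proof.
move=> tX [b Xb [bx By]] [c Xc [cy cz]]; exists b => //; split=> //.
by rewrite (block_unique tX Xb Xc By cy).
Qed.

Lemma same_block_dom (X : blocks) D x y : classical_sets.partition X id D -> same_block X x y -> D x /\ D y.
Proof. by move=> [<- _ _] [b Xb [bx By]]; split; exists b. Qed.

Lemma same_block_sub (X Y : blocks) D : classical_sets.partition X id D ->
  classical_sets.partition Y id D -> (forall x y, same_block X x y <-> same_block Y x y) -> X `<=` Y.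
Proof.
move=> [cX tX neX] [cY tY neY] XY b Xb; have [x bx] := neX b Xb.
have : cover Y id x by rewrite cY -cX; exists b.
move=> [c Yc cx]; suff -> : b = c by [].
apply/seteqP; split=> y.
  move=> By; have [d Yd [dx dy]] : same_block Y x y by apply/XY; exists b.
  by rewrite (block_unique tY Yc Yd cx dx).
move=> cy; have [d Xd [dx dy]] : same_block X x y by apply/XY; exists c.
by rewrite (block_unique tX Xb Xd bx dx).
Qed.

Lemma same_block_eq (X Y : blocks) D : classical_sets.partition X id D ->
  classical_sets.partition Y id D -> (forall x y, same_block X x y <-> same_block Y x y) -> X = Y.
Proof.
move=> pX pY XY; apply/seteqP; split; first exact: (same_block_sub pX pY).
by apply: (same_block_sub pY pX) => x y; rewrite XY.
Qed.

Lemma coarserP (X Y : blocks) D E : classical_sets.partition X id D -> classical_sets.partition Y id E ->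
  coarser X Y <-> forall x y, D x -> D y -> same_block Y x y -> same_block X x y.
Proof.
move=> pX pY; rewrite /coarser (dom_partition pX) (dom_partition pY).
have [cX tX neX] := pX; have [cY tY neY] := pY.
split=> [XY x y Dx Dy [b' Yb' [b'x b'y]]|XY b Xb].
  have [b Xb [bx _]] := same_block_refl pX Dx; exists b => //; split=> //.
  have [S SY bE] := XY b Xb.
  have : (b `&` E) x by split=> //; rewrite -cY; exists b'.
  rewrite bE => -[c Sc [cx _]].
  have cb' := block_unique tY (SY c Sc) Yb' cx b'x.
  have : (\bigcup_(b' in S) (b' `&` D)) y by exists c => //; rewrite cb'.
  by rewrite -bE => -[].
exists [set b' | Y b' /\ exists2 x, b x & b' x] => [b' []//|].
apply/seteqP; split=> y.
  move=> [By Ey]; have [b' Yb' [b'y _]] := same_block_refl pY Ey.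
  exists b'; first by split=> //; exists y.
  by split=> //; rewrite -cX; exists b.
move=> [b' [Yb' [x bx b'x]] [b'y Dy]].
have [c Xc [cx cy]] : same_block X x y.
  by apply: XY => //; [rewrite -cX; exists b|exists b'].
split; first by rewrite (block_unique tX Xb Xc bx cx).
by rewrite -cY; exists b'.
Qed.

Lemma initialP (X Y : blocks) D E : classical_sets.partition X id D -> classical_sets.partition Y id E ->
  D `<=` E -> initial X Y <-> forall x y, D x -> D y -> (same_block X x y <-> same_block Y x y).
Proof.
move=> pX pY DE; rewrite /initial (dom_partition pX).
have [cX tX neX] := pX; have [cY tY neY] := pY.
split=> [XY x y Dx Dy|XY c Xc].
  split=> [[c Xc [cx cy]]|[b' Yb' [b'x b'y]]].
    have [b Yb cE] := XY c Xc; exists b => //.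
    by move: cx cy; rewrite cE => -[? _] [].
  have [c Xc [cx _]] := same_block_refl pX Dx; exists c => //; split=> //.
  have [b Yb cE] := XY c Xc; move: cx; rewrite cE => -[bx _]; split=> //.
  by rewrite (block_unique tY Yb Yb' bx b'x).
have [x cx] := neX c Xc; have Dx : D x by rewrite -cX; exists c.
have [b Yb [bx _]] := same_block_refl pY (DE x Dx); exists b => //.
apply/seteqP; split=> y.
  move=> cy; have Dy : D y by rewrite -cX; exists c.
  have [d Yd [dx dy]] : same_block Y x y by apply/XY => //; exists c.
  by rewrite (block_unique tY Yb Yd bx dx).
move=> [By Dy]; have [d Xd [dx dy]] : same_block X x y by apply/XY => //; exists b.
by rewrite (block_unique tX Xc Xd cx dx).
Qed.

Lemma same_block_blocks_of f x y : same_block (blocks_of f) x y <-> f x = f y.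
Proof.
split=> [[_ [i ->] [/= -> ->]]//|fxy].
by exists (f @^-1` [set f x]); [exists (f x)|].
Qed.

Lemma same_block_segment_of f n x y : same_block (segment_of f n) x y <-> [/\ x < n, y < n & f x = f y].
Proof.
split=> [[_ [z zn ->] [/= [xn ->] [yn ->]]]//|[xn yn fxy]].
by exists [set z | z < n /\ f z = f x]; [exists x|split].
Qed.

Lemma partition_segment_of f n : classical_sets.partition (segment_of f n) id `I_n.
Proof.
split.
- apply/seteqP; split=> [x [_ [z zn ->] []]//|x xn].
  by exists [set z | z < n /\ f z = f x]; [exists x|].
- move=> _ _ [x xn ->] [y yn ->] [z [[/= _ zx] [_ zy]]].
  by rewrite -zx zy.
- by move=> _ [x xn ->]; exists x.
Qed.

Lemma partition_blocks_of f : rigid f -> classical_sets.partition (blocks_of f) id setT.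
Proof.
move=> [sf _]; split.
- by apply/seteqP; split=> // x _; exists (f @^-1` [set f x]) => //; exists (f x).
- by move=> _ _ [i ->] [j ->] [x [/= -> ->]].
- by move=> _ [i ->]; have [x <-] := sf i; exists x.
Qed.

Lemma infinite_blocks_of f : rigid f -> infinite_set (blocks_of f).
Proof.
move=> [sf _] /(finite_image (fun b => f (get b))) fin; apply: infinite_nat.
apply: sub_finite_set fin => i _; exists (f @^-1` [set i]); first by exists i.
by have [x fx] := sf i; exact: (@getPex _ (f @^-1` [set i]) (ex_intro _ x fx)).
Qed.

Lemma omega_blocks_of f : rigid f -> omega_partitions (blocks_of f).
Proof. by move=> rf; split; [exact: partition_blocks_of|exact: infinite_blocks_of]. Qed.

Lemma segments_segment_of f n : segments (segment_of f n).
Proof. by exists n; exact: partition_segment_of. Qed.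

Lemma segment_of_agree f g n : (forall x, x < n -> f x = g x) -> segment_of f n = segment_of g n.
Proof.
move=> fg; apply: same_block_eq (partition_segment_of f n) (partition_segment_of g n) _ => x y.
by rewrite !same_block_segment_of; split=> -[xn yn]; rewrite ?fg // -?fg.
Qed.

Lemma initial_segment_of f g m n : m <= n -> (forall x, x < m -> f x = g x) ->
  initial (segment_of f m) (segment_of g n).
Proof.
move=> mn fg; have mn' : `I_m `<=` `I_n by move=> x /= xm; exact: leq_trans mn.
apply/(initialP (partition_segment_of f m) (partition_segment_of g n) mn') => x y /= xm ym.
rewrite !same_block_segment_of !fg //; split=> -[_ _ ?]; split=> //; exact: leq_trans mn.
Qed.

(** If one value at x were smaller than the other, it would be taken at an earlier point, which is
    then related to x. *)
Lemma rigid_agree f g n : rigid f -> rigid g ->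
  (forall x y, x < n -> y < n -> (f x = f y <-> g x = g y)) ->
  forall x, x < n -> f x = g x.
Proof.
move=> [_ rf] [_ rg] fg; elim/ltn_ind => x IHx xn.
have IH y : y < x -> f y = g y by move=> yx; apply: IHx => //; exact: ltn_trans xn.
apply/eqP; rewrite eqn_leq (leqNgt (f x)) (leqNgt (g x)); apply/andP.
split; apply/negP => lt.
  have [y yx fy] := rf x _ lt; have yn := ltn_trans yx xn.
  have /(fg y x yn xn) fyx : g y = g x by rewrite -IH.
  by move: lt; rewrite -fy fyx ltnn.
have [y yx gy] := rg x _ lt; have yn := ltn_trans yx xn.
have /(fg y x yn xn) gyx : f y = f x by rewrite IH.
by move: lt; rewrite -gy gyx ltnn.
Qed.

Lemma initial_blocks_of f g n : rigid f -> rigid g ->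
  initial (segment_of f n) (blocks_of g) <-> forall x, x < n -> f x = g x.
Proof.
move=> rf rg.
rewrite (initialP (partition_segment_of f n) (partition_blocks_of rg) (@subsetT _ _)).
split=> [fg|fg x y /= xn yn].
  apply: rigid_agree => // x y xn yn; have := fg x y xn yn.
  by rewrite same_block_segment_of same_block_blocks_of => <-; split=> [?|[]].
by rewrite same_block_segment_of same_block_blocks_of !fg //; split=> [[_ _ ->]|?].
Qed.

Lemma blocks_of_inj f g : rigid f -> rigid g -> blocks_of f = blocks_of g -> f = g.
Proof.
move=> rf rg fg; apply/funext => x; apply: (@rigid_agree f g x.+1) => // y z _ _.
by rewrite -!same_block_blocks_of fg.
Qed.

Lemma coarser_blocks_of f g : rigid f -> rigid g ->
  coarser (blocks_of g) (blocks_of f) <-> below 0 g f.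
Proof.
move=> rf rg; rewrite (coarserP (partition_blocks_of rg) (partition_blocks_of rf)).
split=> [fg|[h _ ->] x y _ _]; last by rewrite !same_block_blocks_of /= => ->.
have [r rE] := choice rf.1; exists (g \o r) => //.
apply/funext => x /=; apply/same_block_blocks_of; apply: fg => //.
by apply/same_block_blocks_of; rewrite rE.
Qed.

Lemma below_agree k n f g : onto k n f -> below k g f -> forall x, x < n -> f x = g x.
Proof. by move=> [fk _] [h hk ->] x /fk /hk. Qed.

Lemma agree_below k n f g : onto k n f -> below 0 g f ->
  (forall x, x < n -> f x = g x) -> below k g f.
Proof.
move=> [_ fk] [h _ ->] fg; exists h => // i /fk [x xn <-].
by rewrite -[LHS]/((h \o f) x) -fg.
Qed.

Definition cone k f : set blocks := [set Y | exists g, [/\ rigid g, below k g f & Y = blocks_of g]].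

(** Number x by counting the classes whose least element precedes the least element [mu x] of its
    own class. *)
Lemma rigid_normal (phi : nat -> nat) : infinite_set (range phi) ->
  exists2 f, rigid f & forall x y, f x = f y <-> phi x = phi y.
Proof.
move=> inf.
have ex x : exists y, phi y == phi x by exists x.
pose mu x := ex_minn (ex x).
have phi_mu x : phi (mu x) = phi x by rewrite /mu; case: ex_minnP => y /eqP.
have mu_min x y : phi y = phi x -> mu x <= y.
  by rewrite /mu; case: ex_minnP => z _ zmin /eqP; exact: zmin.
have mu_eq x y : phi x = phi y -> mu x = mu y.
  by move=> xy; apply/eqP; rewrite eqn_leq !mu_min // phi_mu.
have mu_mu x : mu (mu x) = mu x by apply: mu_eq.
pose N m := count (fun y => mu y == y) (iota 0 m).
have NS m : N m.+1 = N m + (mu m == m).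
  by rewrite /N -addn1 iotaD count_cat /= addn0.
have Nmono m n : m < n -> mu m = m -> N m < N n.
  move=> mn mm; have : N m.+1 <= N n.
    by rewrite -(subnKC mn) /N iotaD count_cat leq_addr.
  by rewrite NS mm eqxx addn1.
have Nsurj m j : j < N m -> exists y, [/\ y < m, mu y = y & N y = j].
  elim: m => // m IHm; rewrite NS; have [mm|_] := eqVneq (mu m) m; last first.
    by rewrite addn0 => /IHm [y [ym ? ?]]; exists y; split=> //; exact: ltnW.
  rewrite addn1 ltnS leq_eqVlt => /orP[/eqP->|/IHm [y [ym ? ?]]]; first by exists m.
  by exists y; split=> //; exact: ltnW.
pose f x := N (mu x).
have fphi x y : f x = f y <-> phi x = phi y.
  split=> [|xy]; last by rewrite /f (mu_eq x y).
  move=> fxy; rewrite -(phi_mu x) -(phi_mu y); congr phi.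
  apply/eqP; rewrite eqn_leq (leqNgt (mu x)) (leqNgt (mu y)); apply/andP.
  by split; apply/negP => /Nmono/(_ (mu_mu _)); rewrite -!/(f _) fxy ltnn.
have rf x j : j < f x -> exists2 y, y < x & f y = j.
  move=> /Nsurj [y [ym yy <-]]; exists y; last by rewrite /f yy.
  by apply: leq_trans ym _; exact: mu_min.
(* A missed value k would bound f, since smaller values precede larger ones, and make the range of
   [phi] finite. *)
exists f => //; split=> // k; apply: contrapT => nk; apply: inf.
have fk x : f x < k.
  rewrite ltnNge; apply/negP; rewrite leq_eqVlt => /orP[/eqP kx|/rf [y _ fy]].
    by apply: nk; exists x.
  by apply: nk; exists y.
have /finite_image : finite_set `I_k by [].
move=> /(_ _ (fun i => phi (get (f @^-1` [set i])))); apply: sub_finite_set.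
move=> _ [x _ <-]; exists (f x); first exact: fk.
by apply/fphi; exact: (@getPex _ (f @^-1` [set f x]) (ex_intro _ x erefl)).
Qed.

Lemma omega_normal (X : blocks) : omega_partitions X -> exists2 f, rigid f & X = blocks_of f.
Proof.
move=> [pX iX]; have [cX tX neX] := pX.
pose be x := [get b | X b /\ b x].
have beP x : X (be x) /\ be x x.
  have [b Xb bx] : cover X id x by rewrite cX.
  by apply: (@getPex _ [set b | X b /\ b x]); exists b.
pose phi x : nat := get (be x).
have phiP x : be x (phi x) by apply: (@getPex _ (be x)); exists x; case: (beP x).
have phi_be x y : phi x = phi y -> be x = be y.
  move=> xy; have [Xx _] := beP x; have [Xy _] := beP y.
  by apply: (block_unique tX Xx Xy (phiP x)); rewrite xy; exact: phiP.
have [|f rf fphi] := @rigid_normal phi.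
  move=> /(finite_image be); apply: contra_not iX; apply: sub_finite_set.
  move=> b Xb; have [x bx] := neX b Xb; exists (phi x); first by exists x.
  have [Xx xx] := beP x.
  rewrite -(block_unique tX Xx Xb xx bx).
  by have [Xp pp] := beP (phi x); exact: (block_unique tX Xp Xx pp (phiP x)).
exists f => //; apply: same_block_eq pX (partition_blocks_of rf) _ => x y.
rewrite same_block_blocks_of fphi; split=> [[b Xb [bx By]]|/phi_be E].
  rewrite /phi; congr get; have [Xx xx] := beP x; have [Xy yy] := beP y.
  by rewrite (block_unique tX Xx Xb xx bx) (block_unique tX Xy Xb yy By).
by have [Xx xx] := beP x; have [_ yy] := beP y; exists (be x); rewrite // E in xx *.
Qed.

Lemma basicP k n f : rigid f -> onto k n f -> basic (segment_of f n) (blocks_of f) = cone k f.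
Proof.
move=> rf fk; apply/seteqP; split=> [Y [/omega_normal [g rg ->]]|_ [g [rg gf ->]]].
  move=> /(initial_blocks_of _ rf rg) fg /(coarser_blocks_of rf rg) gf.
  by exists g; split=> //; exact: agree_below fg.
split; first exact: omega_blocks_of.
  by apply/initial_blocks_of => //; exact: below_agree gf.
by apply/coarser_blocks_of => //; exact: below_mono gf.
Qed.

Lemma nblocks_segment_of k n f : onto k n f -> nblocks (segment_of f n) = k.
Proof.
move=> [fk kf]; apply: card_fset_set.
have -> : segment_of f n = (fun i => [set y | y < n /\ f y = i]) @` `I_k.
  apply/seteqP; split=> [_ [x xn ->]|_ [i /= /kf [x xn <-] <-]]; last by exists x.
  by exists (f x) => //; exact: fk.
apply: inj_card_eq => i j; rewrite !inE /= => /kf [x xn fx] _ ij.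
have : [set y | y < n /\ f y = i] x by split.
by rewrite ij => -[_ <-].
Qed.

(** The value k is new at n, so the block of n in the longer segment is the singleton that [star]
    adds. *)
Lemma star_segment_of k n f : onto k n f -> f n = k -> star (segment_of f n) = segment_of f n.+1.
Proof.
move=> [fk kf] fn.
have old x : x < n -> [set y | y < n /\ f y = f x] = [set y | y < n.+1 /\ f y = f x].
  move=> xn; apply/seteqP; split=> y /= [yn fy]; split=> //; first exact: ltnW.
  move: yn; rewrite ltnS leq_eqVlt => /orP[/eqP yn|//].
  by have := fk x xn; rewrite -fy yn fn ltnn.
have new : [set m | dom (segment_of f n) = `I_m] = [set y | y < n.+1 /\ f y = f n].
  rewrite (dom_partition (partition_segment_of f n)); apply/seteqP; split=> y /=.
    move=> E; have [yn|ny|<- //] := ltngtP y n.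
      by have : `I_n y by []; rewrite E /= ltnn.
    by have : `I_y n by []; rewrite -E /= ltnn.
  move=> [yn fy]; move: yn; rewrite ltnS leq_eqVlt => /orP[/eqP->//|/fk].
  by rewrite fy fn ltnn.
apply/seteqP; split=> b.
  move=> [[x xn ->]|->]; last by exists n.
  by rewrite old //; exists x => //; exact: ltnW.
move=> [x]; rewrite ltnS leq_eqVlt => /orP[/eqP->|xn] ->; last by left; exists x; rewrite ?old.
by right; rewrite -new.
Qed.

Lemma onto_agree k n f g : onto k n f -> (forall x, x < n -> f x = g x) -> onto k n g.
Proof.
move=> [fk kf] fg; split=> [x xn|j /kf [x xn <-]]; first by rewrite -fg // fk.
by exists x => //; rewrite fg.
Qed.

Lemma ontoS k n f : onto k n f -> f n = k -> onto k.+1 n.+1 f.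
Proof.
move=> [fk kf] fn; split=> [x|j].
  by rewrite ltnS leq_eqVlt => /orP[/eqP->|/fk/ltnW //]; rewrite fn.
rewrite ltnS leq_eqVlt => /orP[/eqP->|/kf [x xn <-]]; first by exists n.
by exists x => //; exact: ltnW.
Qed.

Lemma rigid_onto f n : rigid f -> exists k, onto k n f.
Proof.
move=> rf; elim: n => [|n [k [fk kf]]]; first by exists 0.
case: (ltngtP (f n) k) => [fn|kn|fn].
- exists k; split=> [x|j /kf [x xn <-]]; last by exists x => //; exact: ltnW.
  by rewrite ltnS leq_eqVlt => /orP[/eqP->|/fk].
- by have [y /fk yn fy] := rf.2 n k kn; move: yn; rewrite fy ltnn.
- by exists k.+1; exact: ontoS.
Qed.

(** * Game-families as families of rigid surjections *)

Section Bridge.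

Context (F : set blocks) (F_omega : F `<=` omega_partitions) (F_game : game_family F).

Definition rigid_family : set (nat -> nat) := [set f | rigid f /\ F (blocks_of f)].
Notation U := rigid_family.

Lemma family_normal X : F X -> exists2 f, U f & X = blocks_of f.
Proof. by move=> FX; have [f rf XE] := omega_normal (F_omega FX); exists f => //; rewrite /U /= -XE. Qed.

Lemma family_rigid f : U f -> rigid f.
Proof. by case. Qed.

Lemma family_refine h f : rigid f -> U (h \o f) -> U f.
Proof.
have [_ ref _ _] := F_game; move=> rf [rhf Fhf]; split=> //.
apply: ref Fhf; first exact: omega_blocks_of.
by apply/coarser_blocks_of => //; exists h.
Qed.

(* Both finite changes and stems are reduced to the fact that [meet] is coarser
   than both arguments; its maximality is replaced by closure under refinement. *)
Lemma family_meet f s : U f -> segments s -> exists z, [/\ U z,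
  forall x y, f x = f y -> z x = z y & forall x y, same_block s x y -> z x = z y].
Proof.
have [_ _ fin _] := F_game; move=> [rf Ff] ss; have [n ps] := ss.
have pf := partition_blocks_of rf; have [_ tf _] := pf; have [_ ts _] := ps.
have [[pm dm mf ms] _] := meetP tf ts.
have [z Uz mz] := family_normal (fin s _ ss Ff).
have pz := partition_blocks_of (family_rigid Uz).
rewrite mz in mf ms; exists z; split=> // x y.
  by rewrite -!same_block_blocks_of; apply: (coarserP pz pf).1.
by rewrite -same_block_blocks_of; apply: (coarserP pz ps).1.
Qed.

(** The meet z is constant on the classes of g, hence factors through g by a section r; closure
    under refinement then puts g in the family. *)
Lemma family_of_meet f s g : U f -> segments s -> rigid g ->
  (forall z, (forall x y, f x = f y -> z x = z y) ->
    (forall x y, same_block s x y -> z x = z y) ->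
    forall x y, g x = g y -> z x = z y :> nat) -> U g.
Proof.
move=> Uf ss rg H; have [z [Uz zf zs]] := family_meet Uf ss.
have [r rE] := choice rg.1; apply: (@family_refine (z \o r)) => //.
suff -> : z \o r \o g = z by [].
by apply/funext => x /=; apply: H => //; rewrite rE.
Qed.

Lemma family_collapse j a f : U f -> a < j -> U (collapse j a \o f).
Proof.
move=> Uf aj; have rf := family_rigid Uf.
have rg : rigid (collapse j a \o f) by apply: rigid_comp => //; exact: rigid_collapse.
have [n fn [fj jf]] := rigid_first j rf.
(* This segment joins the first point n of block j to a point of block a, which together with f
   generates the merge. *)
apply: (family_of_meet Uf (segments_segment_of (collapse j a \o f) n.+1) rg) => z zf zs x y.
have [m mn fm] := jf a aj.
have nm : z n = z m.
  by apply: zs; apply/same_block_segment_of; split; [|exact: ltnW|rewrite /= fn fm; collapse_lia].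
rewrite /=; have [fx|fx] := eqVneq (f x) j; have [fy|fy] := eqVneq (f y) j.
- by move=> _; apply: zf; rewrite fx fy.
- move=> E; rewrite (zf x n) ?fx // nm; apply: zf; rewrite fm.
  by move: E; rewrite fx; collapse_lia.
- move=> E; rewrite (zf y n) ?fy // nm; apply: zf; rewrite fm.
  by move: E; rewrite fy; collapse_lia.
- by move=> E; apply: zf; move: E fx fy; collapse_lia.
Qed.

(** The relation generated by s and [X] is described explicitly; as s is coarser than [X], no two
    blocks of s get joined. *)
Lemma family_stem s X : segments s -> F X -> coarser s X -> exists f k n,
  [/\ U f, onto k n f, s = segment_of f n & coarser (blocks_of f) X].
Proof.
move=> ss FX; have [n ps] := ss; have [g Ug ->] := family_normal FX.
have rg := family_rigid Ug; have pg := partition_blocks_of rg.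
have [cs ts _] := ps.
move=> /(coarserP ps pg) sg.
(* [A x] is the block of s met by the [X]-block of x, or empty. In the latter case the offset n
   keeps the code apart from those chosen below n. *)
pose A x : set nat := [set y | exists2 z, same_block s z y & g z = g x].
pose phi x : nat := if `[< A x !=set0 >] then xget 0 (A x) else n + g x.
have relg x y w : x < n -> same_block s w y -> g w = g x -> same_block s x y.
  move=> xn wy gwx; apply: (same_block_trans ts _ wy); apply: same_block_sym.
  by apply: sg => //; [case: (same_block_dom ps wy)|apply/same_block_blocks_of].
have phi_in x : A x !=set0 -> A x (phi x) /\ phi x < n.
  move=> ne; rewrite /phi asboolT //; have [y yP] := ne; have Ap := @xgetPex _ 0 (A x) ne.
  by split=> //; have [w wp _] := Ap; have [] := same_block_dom ps wp.
have phi_out x : ~ (A x !=set0) -> phi x = n + g x by move=> ne; rewrite /phi asboolF.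
have Ax x : x < n -> A x x by move=> xn; exists x => //; exact: same_block_refl ps _.
have phi_A x y : A x = A y -> A x !=set0 -> phi x = phi y.
  by move=> Axy ne; rewrite /phi -Axy !asboolT.
have phi_g x y : g x = g y -> phi x = phi y.
  by move=> gxy; rewrite /phi /A gxy.
have phi_s x y : x < n -> y < n -> phi x = phi y <-> same_block s x y.
  move=> xn yn; have [[w wp gw] _] := phi_in x (ex_intro _ x (Ax x xn)).
  split=> [pxy|xy].
    have [[v vp gv] _] := phi_in y (ex_intro _ y (Ax y yn)); rewrite pxy in wp.
    apply: (same_block_trans ts (relg x _ w xn wp gw)); apply: same_block_sym.
    exact: relg vp gv.
  apply: phi_A; last by exists x; exact: Ax.
  apply/seteqP; split=> z [v vz gv]; [exists y|exists x] => //.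
    by apply: (same_block_trans ts _ (relg x z v xn vz gv)); exact: same_block_sym.
  by exact: (same_block_trans ts xy (relg y z v yn vz gv)).
have [|f rf fphi] := @rigid_normal phi.
  move=> fin; apply: infinite_nat.
  have fin2 : finite_set (g @` `I_n `|` (subn^~ n @` range phi)).
    by rewrite finite_setU; split; exact: finite_image.
  apply: sub_finite_set fin2 => i _; have [x gx] := rg.1 i.
  have [[y [w wy gw]]|ne] := pselect (A x !=set0).
    by left; exists w; [case: (same_block_dom ps wy)|rewrite gw].
  by right; exists (phi x); [exists x|rewrite phi_out // addKn].
have [k fk] := rigid_onto n rf; exists f, k, n; split=> //.
- apply: (family_of_meet Ug ss rf) => z zg zs x y /fphi pxy.
  have zA v : A v (phi v) -> z v = z (phi v).
    by move=> [w wp gw]; rewrite -(zg w v gw); exact: zs.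
  have [nx|nx] := pselect (A x !=set0); have [ny|ny] := pselect (A y !=set0).
  + by have [/zA -> _] := phi_in x nx; have [/zA -> _] := phi_in y ny; rewrite pxy.
  + by have [_] := phi_in x nx; rewrite pxy phi_out // ltnNge leq_addr.
  + by have [_] := phi_in y ny; rewrite -pxy phi_out // ltnNge leq_addr.
  + by apply: zg; move: pxy; rewrite !phi_out // => /addnI.
- apply: (same_block_eq ps (partition_segment_of f n)) => x y; rewrite same_block_segment_of.
  split=> [xy|[xn yn /fphi /phi_s]]; last by apply.
  by have [/= xn yn] := same_block_dom ps xy; split=> //; apply/fphi/phi_s.
- apply/(coarserP (partition_blocks_of rf) pg) => x y _ _.
  by rewrite !same_block_blocks_of => gxy; apply/fphi/phi_g.
Qed.

(** Otherwise II wins by always answering with a surjection that carries [J] on: a play won by I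
    would have a limit satisfying every [J n]. *)
Lemma family_game k f (J : nat -> set (nat -> nat)) : U f ->
  (forall n g g', U g -> U g' -> below k g f -> below (k + n) g' g -> J n g -> J n g') ->
  J 0 f ->
  (forall n g, U g -> below k g f -> J n g ->
    exists g', [/\ U g', below (k + n) g' g & J n.+1 g']) ->
  exists g, [/\ U g, below k g f & forall n, J n g].
Proof.
move=> Uf Jdown J0 Jstep; apply: contrapT => none.
have rf := family_rigid Uf.
have [n0 fn0 pre0] := rigid_first k rf.
have [_ _ _ noII] := F_game.
apply: (noII (segment_of f n0) (blocks_of f)).
- exact: segments_segment_of.
- exact: Uf.2.
- apply/(coarserP (partition_segment_of f n0) (partition_blocks_of rf)) => x y /= xn yn.
  by rewrite same_block_blocks_of same_block_segment_of.
(* The cut m is the first point of block k + n, so the segment has k + n blocks and [star] freezes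
   one more. *)
pose reply n f' g m := [/\ U g, below (k + n) g f', J n.+1 g, g m = k + n & onto (k + n) m g].
(* The answer uses only the last move and the stage; the default pair answers moves that admit no
   reply. *)
pose sigma : strategy := fun xs => xget (set0, set0) [set r | exists f' g m,
  [/\ rigid f', last set0 xs = blocks_of f', reply (size xs).-1 f' g m &
    r = (segment_of g m, blocks_of g)]].
have answerP x n f' : rigid f' -> x n = blocks_of f' -> U f' -> below k f' f -> J n f' ->
    exists g m, reply n f' g m /\ answer sigma x n = (segment_of g m, blocks_of g).
  move=> rf' xf' Uf' f'f Jf'.
  have [g [Ug gf' Jg]] := Jstep n f' Uf' f'f Jf'.
  have [m gm prem] := rigid_first (k + n) (family_rigid Ug).
  have lastE : last set0 (mkseq x n.+1) = x n.
    by rewrite -nth_last size_mkseq nth_mkseq.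
  rewrite /answer /sigma size_mkseq lastE.
  case: xgetP => [r _ [f'' [g' [m' [rf'' xf'' rep ->]]]]|].
    rewrite xf' in xf''; rewrite -(blocks_of_inj rf' rf'' xf'') in rep.
    by exists g', m'.
  move=> /(_ (segment_of g m, blocks_of g)) []; exists f', g, m; split=> //.
(* A legal move of I is given by some f' below f satisfying [J n]; the link to the previous answer
   is kept for the limit. *)
have positionP x n : (forall m, m <= n -> legalI F (segment_of f n0) (blocks_of f) sigma x m) ->
    exists f' m', [/\ U f', x n = blocks_of f', below k f' f, J n f' &
      [/\ (position (segment_of f n0) (blocks_of f) sigma x n).1 = segment_of f' m',
        onto (k + n) m' f', required_nblocks (segment_of f n0) sigma x n = k + n &
        if n is p.+1 then exists g m, answer sigma x p = (segment_of g m, blocks_of g) /\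
          rigid g /\ below (k + n) f' g else True]].
  elim: n => [|n IHn] leg; have [Fx] := leg _ (leqnn _).
    rewrite /= (basicP rf pre0) => -[f' [rf' f'f xf']].
    have fa := below_agree pre0 f'f.
    have Uf' : U f' by split=> //; rewrite -xf'.
    exists f', n0; split=> //; first by apply: (Jdown 0 f f') => //; [exact: below_refl|rewrite addn0].
    split; rewrite ?addn0 //; first exact: segment_of_agree.
      exact: onto_agree fa.
    exact: nblocks_segment_of.
  have [|f' [m' [Uf' xf' f'f Jf' _]]] := IHn; first by move=> m mn; exact/leg/ltnW.
  have [g [m [[Ug gf' Jg gm prem] ansE]]] := answerP x n f' (family_rigid Uf') xf' Uf' f'f Jf'.
  rewrite /= ansE /= (star_segment_of prem gm).
  have prem' := ontoS prem gm; have rg := family_rigid Ug.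
  rewrite (basicP rg prem') => -[h [rh hg xh]].
  have Uh : U h by split=> //; rewrite -xh.
  have gf : below k g f by apply: below_trans f'f; apply: below_mono gf'; exact: leq_addr.
  have ha := below_agree prem' hg.
  exists h, m.+1; split=> //; rewrite ?addnS.
  - by apply: below_trans gf; apply: below_mono hg; rewrite -addnS leq_addr.
  - apply: (Jdown n.+1 g h) => //; rewrite addnS //.
  - split=> //; [exact: segment_of_agree|exact: onto_agree ha|by rewrite (nblocks_segment_of prem)|].
    by exists g, m.
exists sigma => x; split=> [n leg|leg [Y [pY Yans FY]]].
  have [f' [m' [Uf' xf' f'f Jf' [posE prem' reqE _]]]] := positionP x n leg.
  have [g [m [[Ug gf' Jg gm prem] ansE]]] := answerP x n f' (family_rigid Uf') xf' Uf' f'f Jf'.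
  have rg := family_rigid Ug.
  have f'a := below_agree prem' gf'.
  rewrite /legalII ansE posE reqE (star_segment_of prem gm); split.
  - by split; [exact: segments_segment_of|exact: Ug.2].
  - by rewrite xf' (basicP (family_rigid Uf') prem'); exists g.
  - apply: (initial_segment_of _ f'a); rewrite leqNgt; apply/negP => /ltnW mm'.
    by have [/(_ m mm')] := onto_agree prem' f'a; rewrite gm ltnn.
  - by apply/initial_blocks_of.
  - exact: nblocks_segment_of.
have play n : exists p : (nat -> nat) * nat,
    [/\ U p.1, J n.+1 p.1, p.1 p.2 = k + n, onto (k + n) p.2 p.1 &
        answer sigma x n = (segment_of p.1 p.2, blocks_of p.1)] /\
    [/\ below k p.1 f & if n is q.+1 then exists g m, answer sigma x q = (segment_of g m, blocks_of g) /\
        rigid g /\ below (k + n) p.1 g else True].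
  have [f' [m' [Uf' xf' f'f Jf' [_ prem' _ prev]]]] := positionP x n (fun m _ => leg m).
  have [g [m [[Ug gf' Jg gm prem] ansE]]] := answerP x n f' (family_rigid Uf') xf' Uf' f'f Jf'.
  exists (g, m); split=> //; split.
    by apply: below_trans f'f; apply: below_mono gf'; exact: leq_addr.
  case: n prev gf' {leg xf' Jf' prem' Jg gm prem ansE} => // n [h [l [-> [rh f'h]]]] gf'.
  by exists h, l; split=> //; split=> //; exact: below_trans f'h.
have {play} [p Hp] := choice play.
pose g n := (p n).1; pose m n := (p n).2.
have Ug n : U (g n) by case: (Hp n) => -[].
have Jg n : J n.+1 (g n) by case: (Hp n) => -[].
have gm n : g n (m n) = k + n by case: (Hp n) => -[].
have pre_g n : onto (k + n) (m n) (g n) by case: (Hp n) => -[].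
have ansE n : answer sigma x n = (segment_of (g n) (m n), blocks_of (g n)) by case: (Hp n) => -[].
have gf n : below k (g n) f by case: (Hp n) => _ [].
have rg n : rigid (g n) by exact: family_rigid.
have gS n : below (k + n).+1 (g n.+1) (g n).
  have [_ [_ [h [l [E [rh]]]]]] := Hp n.+1; rewrite ansE in E.
  have [_ /(blocks_of_inj (rg n) rh) <-] : segment_of (g n) (m n) = segment_of h l /\
    blocks_of (g n) = blocks_of h by case: E.
  by rewrite addnS.
have gle n q : n <= q -> below 0 (g q) (g n).
  move=> /subnKC <-; elim: (q - n) => [|d IHd]; first by rewrite addn0; exact: below_refl.
  by rewrite addnS; apply: below_trans IHd; exact: below_mono (gS _).
have m_ge n : n <= m n.
  by apply: leq_trans (rigid_le (m n) (rg n)); rewrite gm leq_addl.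
have mS n : m n < m n.+1.
  rewrite ltnNge; apply/negP => mm.
  have := below_agree (ontoS (pre_g n) (gm n)) (gS n) (x := m n.+1).
  rewrite ltnS => /(_ mm); rewrite gm => E.
  have [/(_ (m n.+1))] := ontoS (pre_g n) (gm n).
  by rewrite ltnS E addnS ltnn => /(_ mm).
have [y Uy YE] := family_normal FY; have ry := family_rigid Uy.
have gy n z : z < m n -> g n z = y z.
  by have := Yans n; rewrite ansE YE /= => /(initial_blocks_of _ (rg n) ry); apply.
(* Points u, v in one block of [g n] stay together in every later [g q], and [g q] agrees with y at
   both once q exceeds u + v. *)
have yg n : below (k + n).+1 y (g n).
  apply: agree_below (ontoS (pre_g n) (gm n)) _ _ => [|z zm].
    apply/coarser_blocks_of => //.
    apply/(coarserP (partition_blocks_of ry) (partition_blocks_of (rg n))) => u v _ _.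
    rewrite !same_block_blocks_of; pose q := n + (u + v).+1 => guv.
    have [h _ gE] := gle n q (leq_addr _ _).
    by rewrite -!(gy q) ?gE /= ?guv //; apply: leq_trans (m_ge q); rewrite /q; lia.
  rewrite (below_agree (ontoS (pre_g n) (gm n)) (gS n)) // gy //.
  exact: leq_ltn_trans (mS n).
have yf : below k y f by apply: below_trans (gf 0); apply: below_mono (yg 0); rewrite addn0.
apply: none; exists y; split=> // -[|n].
  by apply: (Jdown 0 f y) => //; [exact: below_refl|rewrite addn0].
apply: (Jdown n.+1 (g n) y) => //.
by rewrite addnS.
Qed.

End Bridge.

(** * Forcing *)

Section ForcingTheorems.

Context (P : Type) (leP : P -> P -> Prop).
Context (leP_refl : forall p, leP p p).
Context (leP_trans : forall q p r, leP p q -> leP q r -> leP p r).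

Lemma dense_below_le p q D : leP q p -> dense_below leP p D -> dense_below leP q D.
Proof. by move=> qp Dp r rq; apply: Dp; exact: leP_trans qp. Qed.

Lemma dense_below_dense p (D : set P) :
  dense_below leP p [set r | dense_below leP r D] -> dense_below leP p D.
Proof.
move=> dD q /dD [r rq /(_ r (leP_refl r)) [r' r'r Dr']].
by exists r' => //; exact: leP_trans rq.
Qed.

Lemma forces_eq_le x y p q : leP q p -> forces_eq leP x y p -> forces_eq leP x y q.
Proof.
case: x y => A f a [B g b] qp /= [H1 H2].
by split=> i r rq; [apply: H1|apply: H2]; exact: leP_trans qp.
Qed.

Lemma forces_eq_dense x y p : dense_below leP p (forces_eq leP x y) -> forces_eq leP x y p.
Proof.
case: x y => A f a [B g b] /= dp.
split=> i q qp qi; apply: dense_below_dense => r rq.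
all: have [r' r'r [H1 H2]] := dp r (leP_trans rq qp); exists r' => //.
  by apply: H1 => //; exact: leP_trans (leP_trans r'r rq) qi.
by apply: H2 => //; exact: leP_trans (leP_trans r'r rq) qi.
Qed.

Lemma forces_formula_le n (phi : formula P n) e p q : leP q p ->
  forces_formula leP phi e p -> forces_formula leP phi e q.
Proof.
elim: phi e p q => {n} [n t u|n t u|n phi IH|n phi IH psi IH'|n phi IH] e p q qp /=.
- exact: forces_eq_le.
- by case: (eval e u) => B g b; exact: dense_below_le.
- by move=> H r rq; apply: H; exact: leP_trans qp.
- by move=> [H H']; split; [exact: IH H|exact: IH' H'].
- exact: dense_below_le.
Qed.

(** Membership and existence are density statements themselves, and negation follows from
    monotonicity. *)
Lemma forces_formula_dense n (phi : formula P n) e p :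
  dense_below leP p (forces_formula leP phi e) -> forces_formula leP phi e p.
Proof.
elim: phi e p => {n} [n t u|n t u|n phi IH|n phi IH psi IH'|n phi IH] e p /=.
- exact: forces_eq_dense.
- by case: (eval e u) => B g b; exact: dense_below_dense.
- move=> dp q qp fq; have [r rq nr] := dp q qp.
  exact: (nr r) (forces_formula_le rq fq).
- by move=> dp; split; [apply: IH|apply: IH'] => q /dp [r rq []]; exists r.
- exact: dense_below_dense.
Qed.

End ForcingTheorems.

(** * Deciding a sentence with the stem kept *)

Theorem theorem4p3 (F : set blocks) (F_omega : subset F omega_partitions)
    (F_game : game_family F) (Phi : sentence (condition F))
    (p : condition F) :
  exists q : condition F,
    [/\ stem q = stem p, condition_le q p &
        forces (@condition_le F) q Phi \/
        forces (@condition_le F) q (FNeg Phi)].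
Proof.
have cle_refl (q : condition F) : condition_le q q by [].
have cle_trans (q q1 q2 : condition F) : condition_le q1 q -> condition_le q q2 -> condition_le q1 q2.
  by move=> H H' Y /H /H'.
pose U := rigid_family F.
have U_cond k n f : U f -> onto k n f -> exists q : condition F,
    stem q = segment_of f n /\ basic (stem q) (side q) = cone k f.
  move=> [rf Ff] fk; have sf : coarser (segment_of f n) (blocks_of f).
    apply/(coarserP (partition_segment_of f n) (partition_blocks_of rf)) => x y /= xn yn.
    by rewrite same_block_blocks_of same_block_segment_of.
  by exists (Condition (segments_segment_of f n) Ff sf); split=> //=; exact: basicP.
(* Merging the side along the stem gives a cone below the condition with the same stem. *)
have cond_U (q : condition F) : exists f k n, [/\ U f, onto k n f, stem q = segment_of f n &
    cone k f `<=` basic (stem q) (side q)].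
  have [f [k [n [Uf fk sE co]]]] :=
    family_stem F_omega F_game (stem_segment q) (side_in q) (@stem_coarser F q).
  exists f, k, n; split=> // Y; rewrite -(basicP Uf.1 fk) sE => -[oY sY Yf]; split=> //.
  have [g rg XE] := omega_normal (F_omega _ (side_in q)); rewrite XE in co *.
  have [y ry YE] := omega_normal oY; rewrite YE in Yf *.
  move: co Yf => /(coarser_blocks_of rg Uf.1) fg /(coarser_blocks_of Uf.1 ry) yf.
  by apply/coarser_blocks_of => //; exact: below_trans fg.
pose D k : set (nat -> nat) := [set f | exists q : condition F,
  basic (stem q) (side q) = cone k f /\ forces (@condition_le F) q Phi].
have coneS k l f g : k <= l -> below k g f -> cone l g `<=` cone k f.
  move=> kl gf _ [h [rh hg ->]]; exists h; split=> //.
  by apply: below_trans gf; exact: below_mono hg.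
have D_forces k f (q : condition F) : basic (stem q) (side q) `<=` cone k f -> D k f ->
    forces (@condition_le F) q Phi.
  move=> qf [r [rE rPhi]]; apply: forces_formula_le rPhi => //.
  by rewrite /condition_le rE.
have forces_D k f (q : condition F) : U f -> cone k f `<=` basic (stem q) (side q) ->
    forces (@condition_le F) q Phi -> D k f.
  move=> Uf fq qPhi; have [n _ fk] := rigid_first k Uf.1.
  have [r [_ rE]] := U_cond k n f Uf fk; exists r; split=> //.
  by apply: forces_formula_le qPhi => //; rewrite /condition_le rE.
have Ddown k l g g' : U g -> U g' -> k <= l -> below k g' g -> D k g -> D l g'.
  move=> Ug Ug' kl g'g [q [qE qPhi]]; apply: forces_D qPhi => //.
  by rewrite qE; exact: coneS.
have cone_le k l z f (r : condition F) : U z -> cone l z `<=` basic (stem r) (side r) ->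
    basic (stem r) (side r) `<=` cone k f -> below k z f.
  move=> Uz zr rf; have [|h [rh hf]] := rf (blocks_of z).
    by apply: zr; exists z; split=> //; [exact: Uz.1|exact: below_refl].
  by move=> /(blocks_of_inj Uz.1 rh) ->.
(* By density: every r below contains the cone of some (l, z), and freezing at least [k.+1] blocks
   of z gives a condition below both r and the extension (k.+1, z). *)
have Dstep k g : U g -> (forall g', U g' -> below k g' g -> D k.+1 g') -> D k g.
  move=> Ug H; have [n _ gk] := rigid_first k Ug.1.
  have [q [_ qE]] := U_cond k n g Ug gk; exists q; split=> //.
  apply: forces_formula_dense => // r rq.
  have [z [l [m [Uz zl rz zr]]]] := cond_U r.
  have zg : below k z g by apply: cone_le Uz zr _; rewrite -qE.
  have [n' _ zk] := rigid_first (maxn l k.+1) Uz.1.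
  have [t [_ tE]] := U_cond _ n' z Uz zk.
  exists t; first by apply: subset_trans zr; rewrite tE; apply: coneS => //; [exact: leq_maxl|exact: below_refl].
  apply: (D_forces k.+1 z); last exact: H.
  by rewrite tE; apply: coneS; [exact: leq_maxr|exact: below_refl].
have [f [K [n [Uf fK sE fp]]]] := cond_U p.
have [g [Ug gf dec]] := decision (@family_rigid F) (family_collapse F_omega F_game)
  (family_refine F_game) (family_game F_omega F_game) Ddown Dstep K Uf.
have ga := below_agree fK gf.
have [q [sq qE]] := U_cond K n g Ug (onto_agree fK ga).
exists q; split.
- by rewrite sq sE; apply: esym; exact: segment_of_agree.
- by apply: subset_trans fp; rewrite qE; exact: coneS.
case: dec => [Dg|nD]; first by left; apply: D_forces Dg; rewrite qE.
right=> r rq rPhi.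
have [z [l [m [Uz zl rz zr]]]] := cond_U r.
have zg : below K z g by apply: cone_le Uz zr _; rewrite -qE.
(* A condition r forcing the sentence puts [D] at level l, hence at [maxn l K], which [nD]
   excludes. *)
apply: (nD (maxn l K) z (leq_maxr _ _) Uz zg).
apply: Ddown (forces_D l z r Uz zr rPhi) => //; first exact: leq_maxl.
exact: below_refl.
Qed.
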